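(* Assume that the global singular-value gap $$\gamma:=\inf_{f\in\operatorname{Dom}(L)\cap L^2_0(\mu)\setminus\{0\}}\frac{\|Lf\|}{\|f\|}$$ satisfies $\gamma>0$. Then for every $t>0$: (i) $\displaystyle \Delta_t\le\frac{2}{\sqrt{\gamma\,t}}$; (ii) $\displaystyle \sup_{s\in[t,2t]}\Delta_s\ge\frac{1}{\frac32\,\gamma\,t+3}$.
   Context: Let $(X_t)_{t\ge0}$ be a time-homogeneous Markov process on a measurable space $S$, with jointly measurable sample paths and an invariant probability measure $\mu$. $L^2(\mu)$ is the space of complex-valued square-integrable functions with $\langle f,g\rangle=\int \bar f g\,d\mu$ and norm $\|\cdot\|$; $L^2_0(\mu)=\{g\in L^2(\mu):\int g\,d\mu=0\}$. The semigroup $P_tg(x)=\mathbb E_x[g(X_t)]$ is assumed strongly continuous on $L^2(\mu)$; its generator is $Lg=\lim_{t\downarrow0}(P_tg-g)/t$ with $\operatorname{Dom}(L)$ the set of $g\in L^2(\mu)$ for which the limit exists in $L^2(\mu)$. $\mathbb E_\mu$ denotes expectation for the process started from $X_0\sim\mu$. Write $\mu g=\int g\,d\mu$, $\mu_tg=\frac1t\int_0^tg(X_s)\,ds$, $\operatorname{Var}_\mu(\mu_tg)=\mathbb E_\mu|\mu_tg-\mu g|^2$, and $$\Delta_t:=\sup_{g\in L^2_0(\mu),\ \|g\|=1}\sqrt{\operatorname{Var}_\mu(\mu_tg)}.$$ Usual conventions in degenerate cases: $\inf\emptyset=+\infty$, $\sup\emptyset=0$, $1/\infty=0$. *)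

(* Defs.v *)
From HB Require Import structures.
From mathcomp Require Import all_boot all_order all_algebra.
From mathcomp Require Import all_classical all_reals all_analysis.
From mathcomp Require Import complex.

Set Implicit Arguments.
Unset Strict Implicit.
Unset Printing Implicit Defensive.

Import Order.TTheory GRing.Theory Num.Theory.
Import numFieldNormedType.Exports.
Import ComplexField.Normc.

Local Open Scope classical_set_scope.
Local Open Scope ring_scope.
Local Open Scope complex_scope.

Section complex_L2.
Context d (T : measurableType d) (R : realType).
Variable mu : {measure set T -> \bar R}.

Definition cmeasurable (f : T -> R[i]) : Prop :=
  measurable_fun setT (fun x => complex.Re (f x)) /\
  measurable_fun setT (fun x => complex.Im (f x)).

(* Where f is not integrable this takes a conventional value.  For g in L^2(mu)
   this affects P_t g only on a mu-null set and the time average of g only on a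
   null set for the law of the stationary process. *)
Definition cintegral (D : set T) (f : T -> R[i]) : R[i] :=
  (\int[mu]_(x in D) complex.Re (f x)) +i*
  (\int[mu]_(x in D) complex.Im (f x)).

(* Elements of L^2(mu) are represented by functions; equality in L^2(mu) is
   equality mu-almost everywhere. *)
Definition L2norm (f : T -> R[i]) : \bar R :=
  ('N[mu]_2%:E[EFin \o (@normc R \o f)])%E.

Definition L2 : set (T -> R[i]) :=
  [set f | cmeasurable f /\ (L2norm f < +oo)%E].

Definition L20 : set (T -> R[i]) :=
  [set f | L2 f /\ cintegral setT f = 0].

End complex_L2.

Section markov.
Context (R : realType) (d d' : measure_display).
Context (S : measurableType d) (Omega : measurableType d').
Variables (P : R.-pker S ~> Omega) (X : R -> Omega -> S).

(* sigma(X_u, 0 <= u <= s) *)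
Definition past (s : R) : set (set Omega) :=
  <<s [set X up.1 @^-1` up.2 | up in
        [set up : R * set S | 0 <= up.1 <= s /\ measurable up.2]] >>.

(* Only the variables X t with t >= 0 are constrained, and only these are used.
   The initial condition reads P_x (X_0 \in A) = 1_A(x), as singletons of S need
   not be measurable.  The last condition is the time-homogeneous Markov property
   P_x (X_(s+t) \in A | sigma(X_u, u <= s)) = P_(X_s) (X_t \in A), P_x-a.s.,
   in integrated form. *)
Record markov_process : Prop := MarkovProcess {
  markov_jointly_measurable :
    measurable_fun ([set t : R | 0 <= t] `*` [set: Omega])
      (fun tw : R * Omega => X tw.1 tw.2) ;
  markov_start : forall x A, measurable A ->
    P x (X 0 @^-1` A) = (\1_A x)%:E ;
  markov_property : forall x s t A B, 0 <= s -> 0 <= t ->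
    measurable A -> past s B ->
    P x (B `&` X (s + t) @^-1` A) =
    (\int[P x]_(w in B) P (X s w) (X t @^-1` A))%E
}.

Variable mu : probability S R.

Definition invariant_measure : Prop := forall t A, 0 <= t -> measurable A ->
  (\int[mu]_x P x (X t @^-1` A))%E = mu A.

(* The law P_mu of the process started from X_0 ~ mu. *)
Definition Pmu (A : set Omega) : \bar R := (\int[mu]_x P x A)%E.

Let Pmu0 : Pmu set0 = 0%E.
Proof. by rewrite /Pmu; under eq_integral do rewrite measure0; rewrite integral0. Qed.

Let Pmu_ge0 A : (0 <= Pmu A)%E.
Proof. exact: integral_ge0. Qed.

Let Pmu_sigma_additive : semi_sigma_additive Pmu.
Proof.
move=> F mF tF mUF.
rewrite (_ : Pmu _ = (\int[mu]_x \sum_(n <oo) P x (F n))%E); last first.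
  by apply: eq_integral => x _; apply/esym/cvg_lim => //;
    exact: measure_semi_sigma_additive.
rewrite integral_nneseries//; last by move=> n; exact: measurable_kernel.
apply: is_cvg_nneseries => n _ _; exact: integral_ge0.
Qed.

HB.instance Definition _ := isMeasure.Build _ _ _ Pmu
  Pmu0 Pmu_ge0 Pmu_sigma_additive.

Let Pmu_setT : Pmu setT = 1%E.
Proof.
rewrite /Pmu; under eq_integral do rewrite prob_kernel.
by rewrite integral_cst// mul1e; exact: probability_setT.
Qed.

HB.instance Definition _ := Measure_isProbability.Build _ _ _ Pmu Pmu_setT.

Definition semigroup (t : R) (g : S -> R[i]) (x : S) : R[i] :=
  cintegral (P x) setT (fun w => g (X t w)).

(* For a contraction semigroup, strong continuity at 0 is strong continuity on
   [0, +oo[. *)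
Definition strongly_continuous : Prop := forall g, L2 mu g ->
  L2norm mu (fun x => semigroup t g x - g x) @[t --> 0^'+] --> 0%E.

(* The graph of the generator: g is in Dom(L) and L g = h in L^2(mu). *)
Definition is_generator (g h : S -> R[i]) : Prop :=
  [/\ L2 mu g, L2 mu h &
    L2norm mu (fun x => (semigroup t g x - g x) / t%:C - h x)
      @[t --> 0^'+] --> 0%E].

Definition sv_gap : \bar R :=
  ereal_inf [set r | exists f h, [/\ is_generator f h, L20 mu f,
    ~ {ae mu, forall x, f x = 0} & r = (L2norm mu h / L2norm mu f)%E]].

Definition time_average (t : R) (g : S -> R[i]) (w : Omega) : R[i] :=
  (t^-1)%:C * cintegral lebesgue_measure `[0, t] (fun s => g (X s w)).

Definition Var (t : R) (g : S -> R[i]) : \bar R :=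
  (\int[Pmu]_w ((normc (time_average t g w - cintegral mu setT g)) ^+ 2)%:E)%E.

(* The element 0 is added so that the supremum of the empty set is 0: all the
   other elements are nonnegative. *)
Definition Delta (t : R) : \bar R :=
  ereal_sup ([set sqrte (Var t g) | g in
               [set g | L20 mu g /\ L2norm mu g = 1%E]] `|` [set 0%E]).

End markov.

(* Main.v *)
Require Import Defs.
From HB Require Import structures.
From mathcomp Require Import all_boot all_order all_algebra.
From mathcomp Require Import all_classical all_reals all_analysis.
From mathcomp Require Import measurable_realfun complex ring lra.

(** Write P_t for the semigroup on L^2(mu) and A_t for its integral
    int_0^t P_s ds.  Two facts of semigroup theory link A_t to the generator L:
    - A_t g lies in the domain of L and L (A_t g) = P_t g - g;
    - if f lies in the domain of L then A_t (L f) = P_t f - f.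

    Upper bound.  P_t is a contraction, so the first fact and the definition of
    gamma give |A_u g| <= |P_u g - g| / gamma <= 2 |g| / gamma when g has mean
    zero.  By the Markov property and stationarity,
      E |int_0^t g(X_s) ds|^2 = int_0^t (<g, A_u g> + <g, A_(t-u) g>) du,
    which is at most 4 t |g|^2 / gamma; divided by t^2 this bounds the variance.

    Lower bound.  A_s g is the conditional expectation of int_0^s g(X_u) du
    given X_0, so |A_s g| <= s D |g| for all s in [t, 2t], where D bounds
    Delta_s there.  Take f of mean zero with |L f| <= r |f| for an r close to
    gamma.  Integrating f = P_s f - A_s (L f) over [t, 2t] yields
      t f = (A_(2t) f - A_t f) - int_t^(2t) A_s (L f) ds,
    hence t |f| <= 3 t D |f| + D r |f| int_t^(2t) s ds, and the last integral
    is (3/2) t^2.  Thus 1 <= D ((3/2) r t + 3), and r tends to gamma.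

    Both facts about A_t, and all norm estimates, are obtained weakly: the
    number corr k s g = E[k(X_0) g(X_s)] equals <k, P_s g>, identities are
    tested against every k, and nrm_le_dual takes k to be the function whose
    norm is wanted.  The probabilistic input is markov_dot, the analytic input
    is tint_corr_shift; they lead to real_generator_Ar and Ar_generator, and
    these to variance_upper and variance_lower.

    P_t preserves real and imaginary parts, so all this is done for real
    functions.  A complex pair (f, L f) with |L f| < r |f| splits into two real
    ones, of which at least one satisfies the same inequality. *)

Set Implicit Arguments.
Unset Strict Implicit.
Unset Printing Implicit Defensive.

Import Order.TTheory GRing.Theory Num.Theory.
Import numFieldNormedType.Exports.
Local Open Scope classical_set_scope.
Local Open Scope ring_scope.

(** * The pre-Hilbert space of square-integrable functions *)

Section Rintegral_total.
Context d (T : measurableType d) (R : realType).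
Context (m : {measure set T -> \bar R}).
Implicit Types f g : T -> R.

(** Integrability fails when the positive or the negative part has an infinite
    integral; their difference is then infinite, and fine sends it to 0. *)
Lemma Rintegral_nonintegrable f : measurable_fun setT f ->
  ~ m.-integrable setT (EFin \o f) -> \int[m]_x f x = 0.
Proof.
move=> mf; apply: contra_notP => /eqP f0; apply/integrableP.
split; first exact/measurable_EFinP.
move: f0; rewrite /Rintegral integralE.
have -> : (\int[m]_x `|(EFin \o f) x| =
   \int[m]_x (EFin \o f)^\+ x + \int[m]_x (EFin \o f)^\- x)%E.
  rewrite -ge0_integralD//; last 2 first.
  - exact/measurable_funepos/measurable_EFinP.
  - exact/measurable_funeneg/measurable_EFinP.
  by apply: eq_integral => x _; have /(congr1 (@^~ x)) := fune_abse (EFin \o f).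
have p0 : (0 <= \int[m]_x (EFin \o f)^\+ x)%E by exact: integral_ge0.
have n0 : (0 <= \int[m]_x (EFin \o f)^\- x)%E by exact: integral_ge0.
move: p0 n0.
rewrite -[(fun x : T => (f x)%:E)]/(EFin \o f).
case: (integral _ _ ((EFin \o f)^\+)%E) => [a| |]//;
case: (integral _ _ ((EFin \o f)^\-)%E) => [b| |]//=;
  by rewrite ?eqxx// ltry.
Qed.

(** Both sides vanish when f is not integrable, so constants leave inner
    integrals at every point, with no exceptional null set. *)
Lemma Rintegral_scale f r : measurable_fun setT f ->
  \int[m]_x (r * f x) = r * \int[m]_x f x.
Proof.
move=> mf; have [->|r0] := eqVneq r 0.
  by rewrite mul0r; under eq_Rintegral do rewrite mul0r;
    rewrite Rintegral_cst// mul0r.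
have [fi|fi] := pselect (m.-integrable setT (EFin \o f)).
  by rewrite RintegralZl.
rewrite [in RHS]Rintegral_nonintegrable// mulr0 Rintegral_nonintegrable//.
  exact: measurable_funM.
move=> rfi; apply: fi.
apply: eq_integrable (integrableZl measurableT r^-1 rfi) => // x _ /=.
by rewrite -EFinM mulrA mulVf// mul1r.
Qed.

End Rintegral_total.

Section square_integrable.
Context d (T : measurableType d) (R : realType).
Context (m : {finite_measure set T -> \bar R}).
Implicit Types f g h : T -> R.

Definition sqint f := measurable_fun setT f /\
  (\int[m]_x (f x ^+ 2)%:E < +oo)%E.

(** L^2 is handled through representatives: dot is a semi-inner product, and
    its null vectors are the functions that vanish almost everywhere. *)
Definition dot f g : R := \int[m]_x (f x * g x).

Let sqr_ge0E (r : R) : (0 <= (r ^+ 2)%:E)%E.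
Proof. by rewrite lee_fin sqr_ge0. Qed.

Let measurable_sqr f : measurable_fun setT f ->
  measurable_fun setT (fun x => (f x ^+ 2)%:E).
Proof. by move=> mf; apply/measurable_EFinP; exact: measurable_funX. Qed.

Let normM_le_sqrD (a b : R) : `|a * b| <= a ^+ 2 + b ^+ 2.
Proof.
rewrite ler_norml.
have := sqr_ge0 (a + b); have := sqr_ge0 (a - b).
have := sqr_ge0 a; have := sqr_ge0 b.
by rewrite !expr2 => *; apply/andP; split; nra.
Qed.

Lemma sqint_mul f g : sqint f -> sqint g ->
  m.-integrable setT (EFin \o (fun x => f x * g x)).
Proof.
move=> [mf f2] [mg g2]; apply/integrableP; split.
  by apply/measurable_EFinP; exact: measurable_funM.
have mf2 := measurable_sqr mf; have mg2 := measurable_sqr mg.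
apply: (@le_lt_trans _ _ (\int[m]_x ((f x ^+ 2)%:E + (g x ^+ 2)%:E))%E).
  apply: ge0_le_integral => //.
  - apply: measurableT_comp => //; apply/measurable_EFinP.
    exact: measurable_funM.
  - exact: emeasurable_funD.
  by move=> x _ /=; rewrite -EFinD lee_fin normM_le_sqrD.
by rewrite ge0_integralD//; exact: lte_add_pinfty.
Qed.

Lemma sqintD f g : sqint f -> sqint g -> sqint (fun x => f x + g x).
Proof.
move=> [mf f2] [mg g2]; split; first exact: measurable_funD.
have mf2 := measurable_sqr mf; have mg2 := measurable_sqr mg.
apply: (@le_lt_trans _ _
    (\int[m]_x (2%:E * ((f x ^+ 2)%:E + (g x ^+ 2)%:E)))%E).
  apply: ge0_le_integral => //.
  - by apply: measurable_sqr; exact: measurable_funD.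
  - by apply: measurable_funeM; exact: emeasurable_funD.
  move=> x _ /=; rewrite -EFinD -EFinM lee_fin.
  by have := sqr_ge0 (f x - g x); rewrite !expr2 => h1; nra.
rewrite ge0_integralZl//; last 2 first.
- exact: emeasurable_funD.
- by move=> x _; rewrite adde_ge0.
rewrite ge0_integralD//.
by rewrite lte_mul_pinfty//; exact: lte_add_pinfty.
Qed.

Lemma sqintZ r f : sqint f -> sqint (fun x => r * f x).
Proof.
move=> [mf f2]; split; first exact: measurable_funM.
under eq_integral do rewrite exprMn EFinM.
rewrite ge0_integralZl//; last exact: measurable_sqr.
by rewrite lte_mul_pinfty.
Qed.

Lemma sqintB f g : sqint f -> sqint g -> sqint (fun x => f x - g x).
Proof.
move=> sf sg.
rewrite (_ : (fun x => _) = (fun x => f x + -1 * g x)).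
  exact/sqintD/sqintZ.
by apply/funext => x; rewrite mulN1r.
Qed.

Lemma sqint_cst r : sqint (cst r).
Proof.
split => //; rewrite -[X in integral _ _ X]/(cst (r ^+ 2)%:E) integral_cst//.
rewrite lte_mul_pinfty ?lee_fin ?sqr_ge0//.
by rewrite ltey_eq fin_num_measure.
Qed.

Lemma dotC f g : dot f g = dot g f.
Proof. by apply: eq_Rintegral => x _; rewrite mulrC. Qed.

Lemma dotDl f g h : sqint f -> sqint g -> sqint h ->
  dot (fun x => f x + g x) h = dot f h + dot g h.
Proof.
move=> sf sg sh; rewrite /dot; under eq_Rintegral do rewrite mulrDl.
by rewrite RintegralD//; exact: sqint_mul.
Qed.

Lemma dotZl r f g : sqint f -> sqint g ->
  dot (fun x => r * f x) g = r * dot f g.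
Proof.
move=> sf sg; rewrite /dot; under eq_Rintegral do rewrite -mulrA.
by rewrite RintegralZl//; exact: sqint_mul.
Qed.

Lemma dotBl f g h : sqint f -> sqint g -> sqint h ->
  dot (fun x => f x - g x) h = dot f h - dot g h.
Proof.
move=> sf sg sh; rewrite /dot; under eq_Rintegral do rewrite mulrBl.
by rewrite RintegralB//; exact: sqint_mul.
Qed.

Lemma dotBr f g h : sqint f -> sqint g -> sqint h ->
  dot h (fun x => f x - g x) = dot h f - dot h g.
Proof. by move=> sf sg sh; rewrite dotC dotBl// !(dotC h). Qed.

Lemma dotZr r f g : sqint f -> sqint g ->
  dot g (fun x => r * f x) = r * dot g f.
Proof. by move=> sf sg; rewrite dotC dotZl// (dotC g). Qed.

Lemma dot_ge0 f : 0 <= dot f f.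
Proof. by apply: Rintegral_ge0 => x _; rewrite -expr2 sqr_ge0. Qed.

Definition nrm f := Num.sqrt (dot f f).

Lemma nrm_ge0 f : 0 <= nrm f. Proof. exact: sqrtr_ge0. Qed.

Lemma nrm2 f : nrm f ^+ 2 = dot f f.
Proof. by rewrite sqr_sqrtr// dot_ge0. Qed.

Lemma EFin_dot f : sqint f -> (dot f f)%:E = (\int[m]_x (f x ^+ 2)%:E)%E.
Proof.
move=> sf; rewrite /dot /Rintegral fineK.
  by apply: eq_integral => x _; rewrite expr2.
by apply: integrable_fin_num => //; exact: sqint_mul.
Qed.

Lemma cauchy_schwarz f g : sqint f -> sqint g -> `|dot f g| <= nrm f * nrm g.
Proof.
move=> sf sg.
have H r : 0 <= dot f f + 2 * r * dot f g + r ^+ 2 * dot g g.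
  have := dot_ge0 (fun x => f x + r * g x).
  have sg' := sqintZ r sg; have sp := sqintD sf sg'.
  rewrite (dotDl sf sg' sp) (dotZl r sg sp) (dotC f) (dotC g).
  rewrite !(dotDl sf sg')// !dotZl// (dotC g f).
  by rewrite expr2; lra.
have ff := dot_ge0 f; have gg := dot_ge0 g.
suff K : dot f g ^+ 2 <= dot f f * dot g g.
  rewrite -sqrtrM// -sqrtr_sqr ler_sqrt//.
  by rewrite mulr_ge0.
have [g0|g0] := eqVneq (dot g g) 0.
  have [->|fg0] := eqVneq (dot f g) 0; first by rewrite expr0n/= g0 mulr0.
  (* g is null: this r makes the affine function of r in H equal to -1 *)
  have := H (- (dot f f + 1) / (2 * dot f g)).
  rewrite g0 mulr0 addr0 mulrAC -mulrA.
  rewrite [X in _ + 2 * X](_ : _ = - (dot f f + 1) / 2); last by field.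
  by move=> ?; exfalso; lra.
have {}g0 : 0 < dot g g by rewrite lt_def g0.
(* the minimiser of the quadratic polynomial in r *)
have := H (- dot f g / dot g g).
rewrite (_ : _ + _ + _ = dot f f - dot f g ^+ 2 / dot g g); last first.
  by field; rewrite gt_eqF.
by rewrite subr_ge0 ler_pdivrMr.
Qed.

(** The constant is not optimal, but it makes sense for a null measure and an
    infinite right-hand side. *)
Lemma sqr_Rintegral_le f : measurable_fun setT f ->
  (((\int[m]_x f x) ^+ 2)%:E <=
   (fine (m setT) + 1)%:E * \int[m]_x (f x ^+ 2)%:E)%E.
Proof.
move=> mf; have tau0 : 0 <= fine (m setT) by rewrite fine_ge0.
have [foo|] := ltP (\int[m]_x (f x ^+ 2)%:E)%E +oo%E; last first.
  by rewrite leye_eq => /eqP ->; rewrite gt0_muley ?leey// lte_fin ltr_wpDl.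
have sf : sqint f by [].
have := cauchy_schwarz (sqint_cst 1) sf; rewrite {1}/dot.
under eq_Rintegral do rewrite mul1r.
move=> CS; rewrite -(EFin_dot sf) -EFinM lee_fin -real_normK ?num_real//.
apply: (@le_trans _ _ ((nrm (cst 1) * nrm f) ^+ 2)).
  by rewrite ler_sqr ?nnegrE// mulr_ge0 ?nrm_ge0.
rewrite exprMn !nrm2 ler_wpM2r ?dot_ge0//.
rewrite /dot; under eq_Rintegral do rewrite /= mul1r.
by rewrite Rintegral_cst//= mul1r lerDl.
Qed.

Lemma nrm_eq0_dot f g : sqint f -> sqint g -> nrm f = 0 -> dot f g = 0.
Proof.
move=> sf sg f0; apply/eqP; rewrite -normr_le0.
by rewrite (le_trans (cauchy_schwarz sf sg))// f0 mul0r.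
Qed.

(** Testing against f itself turns a bound on the functional dot f into one on
    the norm. *)
Lemma nrm_le_dual f C : 0 <= C -> dot f f <= nrm f * C -> nrm f <= C.
Proof.
move=> C0; rewrite -nrm2 expr2; have [->//|f0] := eqVneq (nrm f) 0.
by rewrite ler_pM2l// lt_def f0 nrm_ge0.
Qed.

Lemma nrmB_le f g : sqint f -> sqint g ->
  nrm (fun x => f x - g x) <= nrm f + nrm g.
Proof.
move=> sf sg; apply: nrm_le_dual; first by rewrite addr_ge0// nrm_ge0.
have sh := sqintB sf sg.
rewrite dotBl// mulrDr.
have := cauchy_schwarz sf sh; have := cauchy_schwarz sg sh.
by rewrite !ler_norml => /andP[? ?] /andP[? ?]; nra.
Qed.

End square_integrable.

(** The same for the laws given by a kernel, which are plain measures. *)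
Lemma sqr_Rintegral_le_prob d (T : measurableType d) (R : realType)
    (m : {measure set T -> \bar R}) (f : T -> R) : m setT = 1%E ->
  measurable_fun setT f ->
  (((\int[m]_x f x) ^+ 2)%:E <= 2%:E * \int[m]_x (f x ^+ 2)%:E)%E.
Proof.
move=> m1 mf; have moo : (m setT < +oo)%E by rewrite m1 ltry.
pose m' : {finite_measure set T -> \bar R} := mfrestr measurableT moo.
have m'E A : measurable A -> A `<=` setT -> m A = m' A.
  by move=> _ _; rewrite /m' /= /mfrestr /mrestr setIT.
have := sqr_Rintegral_le m' mf.
rewrite -(m'E _ measurableT)// m1 /= [1 + 1]addrC -mulr2n.
by rewrite /Rintegral -!(eq_measure_integral m' m'E).
Qed.

Section image_measure.
Context d0 d1 (T : measurableType d0) (Z : measurableType d1) (R : realType).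
Context (m : {measure set T -> \bar R}) (f : T -> Z).

(** The pushforward together with its structure of measure. *)
Definition image_measure (mf : measurable_fun setT f) :
    {measure set Z -> \bar R} :=
  measure_function_pushforward__canonical__measure_function_Measure m mf.

Context (mf : measurable_fun setT f) (n : {measure set Z -> \bar R}).
Hypothesis fn : forall A, measurable A -> m (f @^-1` A) = n A.

Lemma integral_law (F : Z -> \bar R) : (forall z, 0 <= F z)%E ->
  measurable_fun setT F -> (\int[m]_t F (f t) = \int[n]_z F z)%E.
Proof.
move=> F0 mF; rewrite [RHS](eq_measure_integral (image_measure mf)); last first.
  by move=> A mA _; rewrite -fn.
by rewrite /image_measure /= [RHS]ge0_integral_pushforward.
Qed.

Lemma Rintegral_law (G : Z -> R) : measurable_fun setT G ->
  \int[m]_t G (f t) = \int[n]_z G z.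
Proof.
move=> /measurable_EFinP mG; rewrite /Rintegral; congr fine.
rewrite [LHS]integralE [RHS]integralE; congr (_ - _)%E.
  rewrite -(integral_law (funepos_ge0 (EFin \o G)) (measurable_funepos mG)).
  by apply: eq_integral => u _;
    rewrite -[X in (X^\+)%E]/((EFin \o G) \o f) funepos_comp.
rewrite -(integral_law (funeneg_ge0 (EFin \o G)) (measurable_funeneg mG)).
by apply: eq_integral => u _;
  rewrite -[X in (X^\-)%E]/((EFin \o G) \o f) funeneg_comp.
Qed.

End image_measure.

(** * Disintegration of measures and the exchange of integrals *)

Section disintegration.
Context d (T : measurableType d) (R : realType) (m : {measure set T -> \bar R}).

(** An integrable extended-real function is finite almost everywhere. *)
Lemma integrable_fine_comp (h : T -> \bar R) : m.-integrable setT h ->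
  m.-integrable setT (EFin \o (fine \o h)) /\
  \int[m]_x fine (h x) = fine (\int[m]_x h x)%E.
Proof.
move=> hi; have mh := measurable_int m hi.
have mfh : measurable_fun setT (EFin \o (fine \o h)).
  by apply/measurable_EFinP; exact: measurableT_comp.
split.
  by apply: le_integrable hi => // x _ /=; case: (h x) => //= *; rewrite leey.
rewrite /Rintegral; congr fine; apply: ae_eq_integral => //.
by apply: filterS (integrable_ae measurableT hi) => x /= + _ => /(_ I) ?;
  rewrite fineK.
Qed.

Context d1 (U : measurableType d1) (k : T -> {measure set U -> \bar R}).
Context d2 (Z : measurableType d2) (n : {measure set Z -> \bar R}).
Context (phi : T -> U -> Z).

Definition measurable_family := forall F : Z -> \bar R,
  (forall z, 0 <= F z)%E -> measurable_fun setT F ->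
  measurable_fun setT (fun t => \int[k t]_u F (phi t u))%E.

(** n is the image under phi of the measure m(dt) k(t, du).  The definition is
    by integrals, so that one notion covers a process with a random starting
    point, the joint law of a process at two times, and product measures. *)
Definition disintegrates := measurable_family /\ forall F : Z -> \bar R,
  (forall z, 0 <= F z)%E -> measurable_fun setT F ->
  (\int[n]_z F z = \int[m]_t \int[k t]_u F (phi t u))%E.

Let parts (G : Z -> R) t : \int[k t]_u G (phi t u) =
  fine (\int[k t]_u (EFin \o G)^\+ (phi t u) -
        \int[k t]_u (EFin \o G)^\- (phi t u))%E.
Proof.
rewrite /Rintegral integralE; congr (fine (_ - _)%E).
  by apply: eq_integral => u _;
    rewrite -[X in (X^\+)%E]/((EFin \o G) \o phi t) funepos_comp.
by apply: eq_integral => u _;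
  rewrite -[X in (X^\-)%E]/((EFin \o G) \o phi t) funeneg_comp.
Qed.

Lemma measurable_family_Rintegral (G : Z -> R) : measurable_family ->
  measurable_fun setT G ->
  measurable_fun setT (fun t => \int[k t]_u G (phi t u)).
Proof.
move=> mk /measurable_EFinP mG; under eq_fun do rewrite parts.
have mp := mk _ (funepos_ge0 (EFin \o G)) (measurable_funepos mG).
have mn := mk _ (funeneg_ge0 (EFin \o G)) (measurable_funeneg mG).
by apply: measurableT_comp => //; exact: emeasurable_funB.
Qed.

(** The inner integrals over U may fail to converge for some t; the convention
    that such an integral is 0 changes the outer integrand on a null set. *)
Lemma disint_Rintegral (G : Z -> R) : disintegrates ->
  n.-integrable setT (EFin \o G) ->
  m.-integrable setT (EFin \o (fun t => \int[k t]_u G (phi t u))) /\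
  \int[n]_z G z = \int[m]_t \int[k t]_u G (phi t u).
Proof.
move=> [mk nmk] iG; have mG := measurable_int n iG.
have mp := mk _ (funepos_ge0 (EFin \o G)) (measurable_funepos mG).
have mn := mk _ (funeneg_ge0 (EFin \o G)) (measurable_funeneg mG).
have ip := nmk _ (funepos_ge0 (EFin \o G)) (measurable_funepos mG).
have int := nmk _ (funeneg_ge0 (EFin \o G)) (measurable_funeneg mG).
have ipp : m.-integrable setT (fun t => \int[k t]_u (EFin \o G)^\+ (phi t u))%E.
  apply/integrableP; split => //.
  under eq_integral do rewrite gee0_abs ?integral_ge0//.
  by rewrite -ip; exact: integral_funepos_lt_pinfty.
have inn : m.-integrable setT (fun t => \int[k t]_u (EFin \o G)^\- (phi t u))%E.
  apply/integrableP; split => //.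
  under eq_integral do rewrite gee0_abs ?integral_ge0//.
  by rewrite -int; exact: integral_funeneg_lt_pinfty.
have [i1 e1] := integrable_fine_comp (integrableB measurableT ipp inn).
split; first by apply: eq_integrable i1 => // t _ /=; rewrite parts.
under [RHS]eq_Rintegral do rewrite parts.
by rewrite e1 /Rintegral integralE ip int integralB.
Qed.

End disintegration.

Section integral_of_a_family.
Context d1 d (T1 : measurableType d1) (T : measurableType d) (R : realType).
Context (m1 : {finite_measure set T1 -> \bar R}).
Context (m : {finite_measure set T -> \bar R}).

Lemma disint_prod12 :
  disintegrates m1 (fun=> m) (m1 \x m)%E (fun u w => (u, w)).
Proof.
split=> F F0 mF; first exact: measurable_fun_fubini_tonelli_F.
by rewrite fubini_tonelli1.
Qed.

Lemma disint_prod21 :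
  disintegrates m (fun=> m1) (m1 \x m)%E (fun w u => (u, w)).
Proof.
split=> F F0 mF; first exact: measurable_fun_fubini_tonelli_G.
by rewrite fubini_tonelli2.
Qed.

Context (F : T1 * T -> R) (mF : measurable_fun setT F).
Context (M : R) (F_bound : forall u, (\int[m]_w (F (u, w) ^+ 2)%:E <= M%:E)%E).

Let W w := \int[m1]_u F (u, w).

Let M_ge0 (u : T1) : 0 <= M.
Proof.
rewrite -lee_fin (le_trans _ (F_bound u))// integral_ge0// => w _.
by rewrite lee_fin sqr_ge0.
Qed.

Let mF2 : measurable_fun setT (fun z => (F z ^+ 2)%:E).
Proof. by apply/measurable_EFinP; exact: measurable_funX. Qed.

Let F2_ge0 z : (0 <= (F z ^+ 2)%:E)%E.
Proof. by rewrite lee_fin sqr_ge0. Qed.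

(** By the Cauchy-Schwarz inequality W^2 is at most a constant times the
    integral of F_u^2 over u, whose mean is controlled by M. *)
Lemma sqint_integral_family : sqint m W.
Proof.
have mW : measurable_fun setT W.
  exact: (measurable_family_Rintegral disint_prod21.1 mF).
split => //.
set tau := fine (m1 setT).
have tau0 : 0 <= tau by rewrite fine_ge0.
have F12 := disint_prod12.2 _ F2_ge0 mF2.
have m1F1 := disint_prod12.1 _ F2_ge0 mF2.
have F21 := disint_prod21.2 _ F2_ge0 mF2.
have m1F2 := disint_prod21.1 _ F2_ge0 mF2.
have WF w : ((W w ^+ 2)%:E <= (tau + 1)%:E * \int[m1]_u (F (u, w) ^+ 2)%:E)%E.
  by apply: sqr_Rintegral_le; exact: measurableT_comp.
apply: (@le_lt_trans _ _
    (\int[m]_w ((tau + 1)%:E * \int[m1]_u (F (u, w) ^+ 2)%:E)))%E.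
  apply: ge0_le_integral => //.
  - by move=> w _; rewrite lee_fin sqr_ge0.
  - by apply/measurable_EFinP; exact: measurable_funX.
  - exact: measurable_funeM.
rewrite ge0_integralZl//; last 2 first.
- by move=> w _; exact: integral_ge0.
- by rewrite lee_fin addr_ge0.
rewrite -F21 F12 lte_mul_pinfty ?lee_fin ?addr_ge0//.
apply: (@le_lt_trans _ _ (\int[m1]_u M%:E))%E.
  apply: ge0_le_integral => //.
  - by move=> u _; exact: integral_ge0.
rewrite -[X in integral _ _ X]/(cst M%:E) integral_cst//.
have [->|/set0P[u _]] := eqVneq [set: T1] set0.
  by rewrite measure0 mule0.
by rewrite lte_mul_pinfty ?lee_fin ?(M_ge0 u)// ltey_eq fin_num_measure.
Qed.

(** Fubini: |h F_u| <= h^2 + F_u^2 gives integrability on the product. *)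
Lemma dot_integral_family h : sqint m h ->
  m1.-integrable setT (EFin \o (fun u => dot m h (fun w => F (u, w)))) /\
  dot m h W = \int[m1]_u dot m h (fun w => F (u, w)).
Proof.
move=> sh; have [mh h2] := sh.
pose G (z : T1 * T) := h z.2 * F z.
have mG : measurable_fun setT G.
  by apply: measurable_funM => //; exact: measurableT_comp.
have iG : (m1 \x m)%E.-integrable setT (EFin \o G).
  apply/integrable12ltyP; first exact/measurable_EFinP.
  have mG' : measurable_fun setT (fun z => `|G z|%:E).
    by apply/measurable_EFinP; exact: measurableT_comp.
  have G0 z : (0 <= (`|G z|)%:E)%E by rewrite lee_fin.
  have mi := disint_prod12.1 _ G0 mG'.
  (* K bounds the mean of |h F_u| for every u *)
  pose K := dot m h h + M.
  apply: (@le_lt_trans _ _ (\int[m1]_u K%:E))%E.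
    apply: ge0_le_integral => //.
    - by move=> u _; exact: integral_ge0.
    move=> u _; rewrite /K EFinD (EFin_dot sh).
    apply: le_trans (leeD (lexx _) (F_bound u)).
    rewrite -ge0_integralD//; last 3 first.
    - by move=> x _; rewrite lee_fin sqr_ge0.
    - by apply/measurable_EFinP; exact: measurable_funX.
    - by apply/measurable_EFinP; apply: measurable_funX;
        exact: measurableT_comp.
    apply: ge0_le_integral => //.
    - by apply/measurable_EFinP; apply: measurableT_comp => //;
        exact: measurableT_comp.
    - by apply: emeasurable_funD; apply/measurable_EFinP;
        apply: measurable_funX => //; exact: measurableT_comp.
    move=> w _ /=; rewrite -EFinD lee_fin ler_norml /G/=.
    have := sqr_ge0 (h w + F (u, w)); have := sqr_ge0 (h w - F (u, w)).
    have := sqr_ge0 (h w); have := sqr_ge0 (F (u, w)).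
    rewrite !expr2 => h1' h2' h3 h4; apply/andP; split; nra.
  rewrite -[X in integral _ _ X]/(cst K%:E) integral_cst//.
  have [->|/set0P[u _]] := eqVneq [set: T1] set0.
    by rewrite measure0 mule0.
  rewrite lte_mul_pinfty ?lee_fin ?addr_ge0 ?dot_ge0 ?(M_ge0 u)//.
  by rewrite ltey_eq fin_num_measure.
have [i1 e1] := disint_Rintegral disint_prod12 iG.
have [_ e2] := disint_Rintegral disint_prod21 iG.
split => //; rewrite -[RHS]e1 e2; apply: eq_Rintegral => w _.
by rewrite /G /= Rintegral_scale//; exact: measurableT_comp.
Qed.

End integral_of_a_family.

(** * Integrals of bounded functions over time intervals *)

Section time_integrals.
Context (R : realType).
Local Notation leb := (@lebesgue_measure R).
Implicit Types (a b c : R) (phi psi : R -> R).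

Definition translate c : measurableTypeR R -> measurableTypeR R :=
  fun x => x + c.

Let measurable_translate c : measurable_fun setT (translate c).
Proof. exact: measurable_funD. Qed.

Lemma lebesgue_measure_shift c (A : set R) : measurable A ->
  pushforward leb (translate c) A = leb A.
Proof.
move=> mA; apply/esym.
pose nu : {measure set (measurableTypeR R) -> \bar R} :=
  image_measure leb (measurable_translate c).
apply: (@lebesgue_measure_unique _ nu) => //= _ [[a b]] _ <-.
rewrite /nu /= /pushforward.
rewrite (_ : _ @^-1` _ = `](a - c), (b - c)]%classic); last first.
  by apply/seteqP; split => x /=; rewrite !in_itv/= ltrBlDr lerBrDr.
rewrite !lebesgue_measure_itv/= !lte_fin ltrD2r.
by case: ifP => // _; rewrite -!EFinB opprB addrA addrNK.
Qed.

Definition bounded_measurable phi :=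
  measurable_fun setT phi /\ exists C, forall x, `|phi x| <= C.

Definition tint a b phi : R := \int[leb]_(x in `[a, b]) phi x.

Lemma eq_tint a b phi psi : (forall x, a <= x <= b -> phi x = psi x) ->
  tint a b phi = tint a b psi.
Proof.
by move=> H; apply: eq_Rintegral => x; rewrite inE/= in_itv/=; exact: H.
Qed.

Lemma bounded_measurable_integrable a b phi : bounded_measurable phi ->
  leb.-integrable `[a, b] (EFin \o phi).
Proof.
move=> [mphi [C HC]]; apply: measurable_bounded_integrable => //.
- rewrite /= lebesgue_measure_itv/=.
  by case: ifP => _; rewrite -?EFinB ltry.
- exact: measurable_funTS.
- exists C; split; first exact: num_real.
  by move=> y Cy x _ /=; rewrite (le_trans (HC x))// ltW.
Qed.

Lemma tint_cat a b c phi : bounded_measurable phi -> a <= b -> b <= c ->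
  tint a c phi = tint a b phi + tint b c phi.
Proof.
move=> bphi ab bc; rewrite /tint.
have i1 := bounded_measurable_integrable a c bphi.
have i2 := bounded_measurable_integrable b c bphi.
rewrite -[in X in _ + X](@Rintegral_itv_obnd_cbnd _ b (BRight c)); last first.
  by apply: integrableS i2 => //; exact: subset_itv_oc_cc.
rewrite -(@Rintegral_itvB _ phi (BLeft a) (BRight c) b)//.
by rewrite addrC subrK.
Qed.

Lemma tint_shift a b c phi : bounded_measurable phi ->
  tint a b (fun x => phi (x + c)) = tint (a + c) (b + c) phi.
Proof.
move=> bphi; have [mphi [C HC]] := bphi.
have bpc : bounded_measurable (fun x => phi (x + c)).
  split; first exact: (measurableT_comp mphi (@measurable_translate c)).
  by exists C.
rewrite /tint /Rintegral; congr fine; apply/esym.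
have E : translate c @^-1` `[a + c, b + c]%classic = `[a, b]%classic.
  by apply/seteqP; split => x /=; rewrite !in_itv/= !lerD2r.
transitivity (\int[pushforward leb (translate c)]_(x in
    `[(a + c)%R, (b + c)%R]%classic) (phi x)%:E)%E.
  apply: eq_measure_integral => A mA _; apply/esym.
  exact: lebesgue_measure_shift.
rewrite (integral_pushforward (@measurable_translate c))//.
- by congr (integral _ _ _); exact: E.
- exact/measurable_EFinP.
- have := bounded_measurable_integrable a b bpc.
  by rewrite -E.
Qed.

Lemma tint_opp a b phi : bounded_measurable phi ->
  tint a b (fun x => phi (- x)) = tint (- b) (- a) phi.
Proof.
move=> bphi; have [mphi [C HC]] := bphi.
have mc : measurable_fun setT (-%R : measurableTypeR R -> measurableTypeR R).
  exact: oppr_measurable.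
have bpc : bounded_measurable (fun x => phi (- x)).
  split; first exact: measurableT_comp.
  by exists C.
rewrite /tint /Rintegral; congr fine; apply/esym.
pose h := (-%R : measurableTypeR R -> measurableTypeR R).
have E : h @^-1` `[- b, - a]%classic = `[a, b]%classic.
  by apply/seteqP; split => x /=; rewrite !in_itv/= !lerN2 andbC.
transitivity (\int[pushforward leb h]_(x in
    `[(- b)%R, (- a)%R]%classic) (phi x)%:E)%E.
  by apply: eq_measure_integral => A mA _; apply/esym; exact: lebesgue_measureN.
rewrite (integral_pushforward mc)//.
- by congr (integral _ _ _); exact: E.
- exact/measurable_EFinP.
- have := bounded_measurable_integrable a b bpc.
  by rewrite -E.
Qed.

Lemma tint_cst a b r : a <= b -> tint a b (fun=> r) = r * (b - a).
Proof.
move=> ab; rewrite /tint Rintegral_cst//= lebesgue_measure_itv/= lte_fin.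
by case: (ltgtP a b) ab => [ab|//|->] _ //=; rewrite subrr.
Qed.

Lemma bounded_measurable_cst r : bounded_measurable (fun=> r).
Proof. by split => //; exists `|r|. Qed.

Lemma bounded_measurableB phi psi : bounded_measurable phi ->
  bounded_measurable psi -> bounded_measurable (fun x => phi x - psi x).
Proof.
move=> [m1 [C1 H1]] [m2 [C2 H2]]; split; first exact: measurable_funB.
exists (C1 + C2) => x; rewrite (le_trans (ler_normB _ _))//.
by rewrite lerD.
Qed.

Lemma bounded_measurableZ r phi : bounded_measurable phi ->
  bounded_measurable (fun x => r * phi x).
Proof.
move=> [m1 [C1 H1]]; split; first exact: measurable_funM.
by exists (`|r| * C1) => x; rewrite normrM ler_wpM2l.
Qed.

Lemma tintB a b phi psi : bounded_measurable phi -> bounded_measurable psi ->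
  tint a b (fun x => phi x - psi x) = tint a b phi - tint a b psi.
Proof.
move=> b1 b2; rewrite /tint RintegralB//;
  exact: bounded_measurable_integrable.
Qed.

Lemma tintZ a b r phi : bounded_measurable phi ->
  tint a b (fun x => r * phi x) = r * tint a b phi.
Proof.
move=> bphi; rewrite /tint RintegralZl//.
exact: bounded_measurable_integrable.
Qed.

Lemma le_tint a b phi psi : bounded_measurable phi -> bounded_measurable psi ->
  (forall x, a <= x <= b -> phi x <= psi x) -> tint a b phi <= tint a b psi.
Proof.
move=> b1 b2 H; apply: le_Rintegral => //;
  by [exact: bounded_measurable_integrable].
Qed.

Lemma tint_bound a b phi C : bounded_measurable phi -> a <= b ->
  (forall x, a <= x <= b -> `|phi x| <= C) -> `|tint a b phi| <= C * (b - a).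
Proof.
move=> bphi ab H; rewrite ler_norml -mulNr -!tint_cst//; apply/andP; split;
  apply: le_tint => //; try exact: bounded_measurable_cst;
  by move=> x /H; rewrite ler_norml => /andP[].
Qed.

Lemma bounded_measurableD phi psi : bounded_measurable phi ->
  bounded_measurable psi -> bounded_measurable (fun x => phi x + psi x).
Proof.
move=> [m1 [C1 H1]] [m2 [C2 H2]]; split; first exact: measurable_funD.
exists (C1 + C2) => x; rewrite (le_trans (ler_normD _ _))//.
by rewrite lerD.
Qed.

Lemma bounded_measurable_comp phi (h : R -> R) : measurable_fun setT h ->
  bounded_measurable phi -> bounded_measurable (phi \o h).
Proof.
move=> mh [mphi [C H]]; split; last by exists C => x /=.
exact: measurableT_comp.
Qed.

Lemma tint_reflect a b c phi : bounded_measurable phi ->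
  tint a b (fun x => phi (c - x)) = tint (c - b) (c - a) phi.
Proof.
move=> bphi; have := tint_shift (- b) (- a) c bphi.
rewrite ![- _ + c]addrC => <-.
rewrite -(tint_opp a b (phi := fun x => phi (x + c))).
  by apply: eq_Rintegral => x _; rewrite addrC.
by apply: (bounded_measurable_comp _ bphi); exact: measurable_funD.
Qed.

(** Symmetrising phi about the midpoint of [a, b] turns the linear bound into a
    constant one. *)
Lemma tint_le_linear a b phi C : bounded_measurable phi -> a <= b ->
  (forall x, a <= x <= b -> phi x <= C * x) ->
  tint a b phi <= C * ((b ^+ 2 - a ^+ 2) / 2).
Proof.
move=> bphi ab H.
have br : bounded_measurable (fun x => phi (a + b - x)).
  by apply: (bounded_measurable_comp _ bphi); exact: measurable_funB.
have E : tint a b (fun x => phi x + phi (a + b - x)) = 2 * tint a b phi.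
  rewrite /tint RintegralD//; try exact: bounded_measurable_integrable.
  rewrite -!/(tint _ _ _) tint_reflect// addrK [a + b - a]addrAC subrr add0r.
  by rewrite mulr2n mulrDl mul1r.
have : tint a b (fun x => phi x + phi (a + b - x)) <=
       tint a b (fun=> C * (a + b)).
  apply: le_tint; first exact: bounded_measurableD.
    exact: bounded_measurable_cst.
  move=> x /andP[ax xb].
  rewrite (_ : C * _ = C * x + C * (a + b - x)); last by ring.
  by rewrite lerD// H//; apply/andP; split; lra.
by rewrite E tint_cst// => ?; lra.
Qed.

Lemma window_lty a b : (leb `[a, b]%classic < +oo)%E.
Proof.
by rewrite /= lebesgue_measure_itv/=; case: ifP => _; rewrite -?EFinB ltry.
Qed.

(** The finite measure that turns integrals over [a, b] into integrals over the
    whole line. *)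
Definition window a b : {finite_measure set (measurableTypeR R) -> \bar R} :=
  @mfrestr _ (measurableTypeR R) R _ leb (measurable_itv `[a, b])
    (window_lty a b).

Lemma integral_window_ge0 a b (f : measurableTypeR R -> \bar R) :
  measurable_fun setT f ->
  (forall x, 0 <= f x)%E ->
  (\int[window a b]_x f x = \int[leb]_(x in `[a, b]) f x)%E.
Proof.
move=> mf f0.
have mI : measurable (~` `[a, b]%classic : set (measurableTypeR R)).
  exact: measurableC.
have wE (A : set (measurableTypeR R)) :
  window a b A = leb (A `&` `[a, b]%classic) by [].
have w0 : window a b (~` `[a, b]%classic) = 0%E.
  by rewrite wE setICl measure0.
have := @ge0_negligible_integral _ (measurableTypeR R) R (window a b) setT _ f
  mI measurableT mf (fun x _ => f0 x) w0.
rewrite setTD setCK => ->.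
apply: eq_measure_integral => A mA AI.
by rewrite -[LHS]/(window a b A) wE setIidl.
Qed.

Lemma Rintegral_window a b phi : measurable_fun setT phi ->
  \int[window a b]_x phi x = tint a b phi.
Proof.
move=> mphi.
pose f : measurableTypeR R -> \bar R := EFin \o phi.
have mf : measurable_fun setT f by exact/measurable_EFinP.
have Ep := integral_window_ge0 a b (measurable_funepos mf) (funepos_ge0 f).
have En := integral_window_ge0 a b (measurable_funeneg mf) (funeneg_ge0 f).
rewrite /tint /Rintegral.
transitivity (fine (\int[window a b]_x f x)%E); first by [].
transitivity (fine (\int[leb]_(x in `[a, b]) f x)%E); last by [].
by rewrite integralE Ep En [in RHS]integralE.
Qed.

End time_integrals.

(** * Joint laws determined by a kernel *)

Section kernel_reindex.
Context d0 d1 d2 (T : measurableType d0) (S : measurableType d1)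
  (U : measurableType d2) (R : realType).
Context (k : R.-pker S ~> U) (f : T -> S) (mf : measurable_fun setT f).

(** The measurability of f is an argument so that the instances below apply. *)
Definition kreindex of measurable_fun setT f : T -> {measure set U -> \bar R} :=
  fun t => k (f t).

Let measurable_kreindex A : measurable A ->
  measurable_fun setT (kreindex mf ^~ A).
Proof.
by move=> mA; exact: (measurableT_comp (measurable_kernel k _ mA) mf).
Qed.

HB.instance Definition _ := isKernel.Build _ _ T U R (kreindex mf)
  measurable_kreindex.

Let kreindex_prob t : kreindex mf t setT = 1%E.
Proof. exact: prob_kernel. Qed.

HB.instance Definition _ :=
  @Kernel_isProbability.Build _ _ T U R (kreindex mf) kreindex_prob.

End kernel_reindex.

Section kernel_pushforward.
Context d0 d1 d2 (T : measurableType d0) (U : measurableType d1)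
  (Z : measurableType d2) (R : realType).
Context (k : R.-pker T ~> U).
Context (phi : T * U -> Z) (mphi : measurable_fun setT phi).

Let msection t : measurable_fun setT (fun u => phi (t, u)).
Proof. exact: measurableT_comp. Qed.

Definition kpush : T -> {measure set Z -> \bar R} :=
  fun t => image_measure (k t) (msection t).

Let measurable_kpush A : measurable A -> measurable_fun setT (kpush ^~ A).
Proof.
move=> mA; have mpA : measurable (phi @^-1` A).
  by rewrite -[X in measurable X]setTI; exact: mphi.
have := @measurable_fun_xsection_finite_kernel _ _ T U R k _ (mem_set mpA).
apply: eq_measurable_fun => t _; rewrite /kpush /= /pushforward; congr (k t _).
by apply/seteqP; split => u /=; rewrite /xsection/= ?inE.
Qed.

HB.instance Definition _ := isKernel.Build _ _ T Z R (kpush)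
  measurable_kpush.

Let kpush_prob t : kpush t setT = 1%E.
Proof. by rewrite /kpush /= /pushforward preimage_setT prob_kernel. Qed.

HB.instance Definition _ :=
  @Kernel_isProbability.Build _ _ T Z R (kpush) kpush_prob.

End kernel_pushforward.

Section kernel_disintegration.
Context d0 d1 d2 (T : measurableType d0) (U : measurableType d1)
  (Z : measurableType d2) (R : realType).
Context (m : probability T R) (k : R.-pker T ~> U).
Context (n : {measure set Z -> \bar R}).
Context (phi : T * U -> Z) (mphi : measurable_fun setT phi).
Context (G : set (set Z)) (mG : measurable = <<s G >>) (GI : setI_closed G)
  (GT : G setT).
Hypothesis nT : (n setT < +oo)%E.
Hypothesis nG : forall A, G A ->
  n A = (\int[m]_t k t ((fun u => phi (t, u)) @^-1` A))%E.

(** A probability kernel and an initial law determine the joint law, so the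
    formula need only be known on a pi-system of generators. *)
Lemma disintegrates_generator :
  disintegrates m k n (fun t u => phi (t, u)).
Proof.
split=> F F0 mF.
  by apply: (measurable_fun_integral_finite_kernel (F \o phi));
    [move=> z; exact: F0|exact: measurableT_comp].
pose l := kprobability (measurable_cst (m : pprobability T R)) :
  unit -> {measure set T -> \bar R}.
pose k' := kreindex (kpush k mphi)
  (measurable_snd : measurable_fun setT (@snd unit T)).
have nE A : measurable A -> n A = kcomp l k' tt A.
  move=> mA; apply: (measure_unique G (fun=> setT)) => //.
  by rewrite bigcup_const//; exists 0%N.
transitivity (\int[kcomp l k' tt]_z F z)%E.
  by apply: eq_measure_integral => A mA _; exact: nE.
rewrite integral_kcomp//; apply: eq_integral => t _ /=.
rewrite /k' /kreindex /kpush /= ge0_integral_pushforward//.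
exact: measurableT_comp.
Qed.

End kernel_disintegration.

(** * Arithmetic of the lower bound *)

Section arithmetic.
Context (R : realFieldType).

(** In the lower bound, F is the norm of f, b_1 and b_2 are <f, A_t f> and
    <f, A_(2t) f>, and a_1, a_2 are the norms of A_t f and A_(2t) f. *)
Lemma difference_le (a1 a2 b1 b2 F t D : R) :
  F * a2 <= F * (2 * t * D * F) -> F * a1 <= F * (t * D * F) ->
  `|b1| <= F * a1 -> `|b2| <= F * a2 -> b2 - b1 <= 3 * t * D * F ^+ 2.
Proof.
by move=> h1 h2 /ler_normlP[h3 _] /ler_normlP[_ h4]; rewrite expr2; lra.
Qed.

(** Here F is the squared norm of f and T is the integral of <f, P_s f> over
    [t, 2t]. *)
Lemma average_bound (t F T D r : R) : 0 < t -> 0 < F ->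
  T <= 3 * t * D * F ->
  F * (2 * t - t) - T <= D * r * F * (((2 * t) ^+ 2 - t ^+ 2) / 2) ->
  1 <= D * (3 / 2 * r * t + 3).
Proof.
move=> t0 F0 h1 h2; rewrite -(ler_pM2l (mulr_gt0 t0 F0)) mulr1.
by move: h2; rewrite !expr2; lra.
Qed.

End arithmetic.

(** * The semigroup of a stationary Markov process *)

Section stationary_process.
Context (R : realType) (d d' : measure_display).
Context (S : measurableType d) (Omega : measurableType d').
Context (P : R.-pker S ~> Omega) (X : R -> Omega -> S) (mu : probability S R).
Hypothesis hX : markov_process P X.
Hypothesis hmu : invariant_measure P X mu.
Implicit Types (f g h k : S -> R) (s t u : R).

Let Q : probability Omega R := Pmu P mu.

(** The process is constrained at nonnegative times only; clamping the time
    makes it jointly measurable, with law mu, at all real times. *)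
Definition Xc s w : S := X (Num.max 0 s) w.

Lemma Xc_ge0 s : 0 <= s -> Xc s = X s.
Proof. by move=> s0; rewrite /Xc max_r. Qed.

Lemma jointly_measurable_Xc :
  measurable_fun setT (fun z : measurableTypeR R * Omega => Xc z.1 z.2).
Proof.
have mJ := markov_jointly_measurable hX.
have mD : measurable ([set t : measurableTypeR R | 0 <= t] `*` [set: Omega]).
  apply: measurableX => //.
  rewrite (_ : [set t | _] = `[0, +oo[%classic)//.
  by apply/seteqP; split => x /=; rewrite in_itv/= andbT.
pose cl (z : measurableTypeR R * Omega) : measurableTypeR R * Omega :=
  (Num.max 0 z.1, z.2).
have mcl : measurable_fun setT cl.
  apply: measurable_fun_pair => //.
  by apply: measurable_maxr => //; exact: measurable_fst.
apply: (measurable_comp mD _ mJ mcl).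
by move=> _ [z _ <-] /=; split => //=; rewrite le_max lexx.
Qed.

Lemma measurable_Xc s : measurable_fun setT (Xc s).
Proof.
exact: (measurableT_comp jointly_measurable_Xc
  (measurable_pair1 (s : measurableTypeR R))).
Qed.

Lemma law_Xc s A : measurable A -> Q (Xc s @^-1` A) = mu A.
Proof. by move=> mA; apply: hmu => //; rewrite le_max lexx. Qed.

Lemma sqint_Xc s g : sqint mu g -> sqint Q (g \o Xc s).
Proof.
move=> [mg g2]; split; first exact: measurableT_comp (measurable_Xc s).
rewrite (integral_law (measurable_Xc s) (law_Xc s)
  (F := fun x => (g x ^+ 2)%:E))//.
  by move=> x; rewrite lee_fin sqr_ge0.
by apply/measurable_EFinP; exact: measurable_funX.
Qed.

Lemma dot_Xc s f g : sqint mu f -> sqint mu g ->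
  dot Q (f \o Xc s) (g \o Xc s) = dot mu f g.
Proof.
move=> [mf _] [mg _].
rewrite /dot -(Rintegral_law (measurable_Xc s) (law_Xc s))//.
exact: measurable_funM.
Qed.

Lemma nrm_Xc s f : sqint mu f -> nrm Q (f \o Xc s) = nrm mu f.
Proof. by move=> sf; rewrite /nrm dot_Xc. Qed.

(** P_s on real functions. *)
Definition Pr s g x : R := \int[P x]_w g (Xc s w).

Lemma disint_start : disintegrates mu P Q (fun _ w => w).
Proof.
have H := @disintegrates_generator _ _ _ S Omega Omega R mu P Q snd
  measurable_snd measurable.
apply: H => //.
- by rewrite sigma_algebra_id//; exact: sigma_algebra_measurable.
- by move=> A B; exact: measurableI.
- by rewrite -[X in (X < _)%E]/(Q setT) probability_setT ltry.
Qed.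

Lemma sqint_Pr s g : sqint mu g -> sqint mu (Pr s g).
Proof.
move=> sg; have [mg g2] := sqint_Xc s sg.
have mP : measurable_fun setT (Pr s g).
  exact: (measurable_family_Rintegral disint_start.1 mg).
split => //.
have sq0 w : (0 <= ((g \o Xc s) w ^+ 2)%:E)%E by rewrite lee_fin sqr_ge0.
have mg2 : measurable_fun setT (fun w => ((g \o Xc s) w ^+ 2)%:E).
  by apply/measurable_EFinP; exact: measurable_funX.
have mI := disint_start.1 _ sq0 mg2.
apply: (@le_lt_trans _ _
    (\int[mu]_x (2%:E * \int[P x]_w ((g \o Xc s) w ^+ 2)%:E)))%E.
  apply: ge0_le_integral => //.
  - by move=> x _; rewrite lee_fin sqr_ge0.
  - by apply/measurable_EFinP; exact: measurable_funX.
  - exact: measurable_funeM.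
  by move=> x _; apply: sqr_Rintegral_le_prob => //; exact: prob_kernel.
rewrite ge0_integralZl//; last by move=> x _; exact: integral_ge0.
by rewrite -(disint_start.2 _ sq0 mg2) lte_mul_pinfty.
Qed.

(** On rectangles this is the Markov property at time s, applied to the event
    that X_r lies in A, which belongs to the past of s as r <= s. *)
Lemma disint_markov r s t : 0 <= r -> r <= s -> 0 <= t ->
  disintegrates Q (kreindex P (measurable_Xc s))
    (image_measure Q
      (measurable_fun_pair (measurable_Xc r) (measurable_Xc (s + t))))
    (fun w w' => (Xc r w, Xc t w')).
Proof.
move=> r0 rs t0; have s0 := le_trans r0 rs.
pose phi (z : Omega * Omega) := (Xc r z.1, Xc t z.2).
have mphi : measurable_fun setT phi.
  apply: measurable_fun_pair.
    exact: measurableT_comp (measurable_Xc r) measurable_fst.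
  exact: measurableT_comp (measurable_Xc t) measurable_snd.
pose G : set (set (S * S)) := [set A `*` B | A in measurable & B in measurable].
apply: (disintegrates_generator mphi (G := G)).
- by rewrite measurable_prod_measurableType.
- move=> _ _ [A1 mA1 [A2 mA2 <-]] [B1 mB1 [B2 mB2 <-]].
  exists (A1 `&` B1); first exact: measurableI.
  by exists (A2 `&` B2); [exact: measurableI|rewrite setXI].
- by exists setT => //; exists setT => //; rewrite setXTT.
- by rewrite /image_measure/= /pushforward preimage_setT probability_setT ltry.
move=> _ [A mA [B mB <-]].
have mrA : measurable (Xc r @^-1` A).
  by rewrite -[X in measurable X]setTI; exact: measurable_Xc.
have mtB : measurable (Xc t @^-1` B).
  by rewrite -[X in measurable X]setTI; exact: measurable_Xc.
pose F w := (P (Xc s w) (Xc t @^-1` B) * (\1_(Xc r @^-1` A) w)%:E)%E.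
have mF : measurable_fun setT F.
  apply: emeasurable_funM.
    exact: measurableT_comp (measurable_kernel P _ mtB) (measurable_Xc s).
  by apply/measurable_EFinP; exact: measurable_indic.
have F0 w : (0 <= F w)%E by rewrite mule_ge0 ?lee_fin// indicE.
transitivity (\int[mu]_x \int[P x]_w F w)%E.
  rewrite /image_measure/= /pushforward /Pmu/=; apply: eq_integral => x _.
  rewrite (_ : _ @^-1` _ = Xc r @^-1` A `&` X (s + t) @^-1` B); last first.
    by rewrite -(Xc_ge0 (addr_ge0 s0 t0)).
  rewrite (markov_property hX)//; last first.
    rewrite Xc_ge0//; apply: sub_sigma_algebra.
    by exists (r, A) => //=; rewrite r0 rs.
  rewrite integral_mkcond; apply: eq_integral => w _.
  rewrite /F patchE indicE; case: ifPn => wA.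
    by rewrite /= mule1 !Xc_ge0.
  by rewrite /= mule0.
rewrite -(disint_start.2 _ F0 mF); apply: eq_integral => w _.
rewrite /F /kreindex indicE.
have [wA|wA] := boolP (w \in Xc r @^-1` A).
  rewrite mule1; congr (P _ _); apply/seteqP; split => w' /=; last by case.
  by split => //; move: wA; rewrite inE.
rewrite mule0 (_ : _ @^-1` _ = set0) ?measure0//.
by rewrite -subset0 => w' /= [Aw _]; move: wA; rewrite notin_setE.
Qed.

(** Conditioning on the past of s replaces g(X_(s+t)) by (P_t g)(X_s).  With
    r = 0 this is the semigroup law; with r = s, and stationarity, it computes
    the covariances of the process. *)
Lemma markov_dot r s t f g : 0 <= r -> r <= s -> 0 <= t ->
  sqint mu f -> sqint mu g ->
  dot Q (f \o Xc r) (g \o Xc (s + t)) = dot Q (f \o Xc r) (Pr t g \o Xc s).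
Proof.
move=> r0 rs t0 sf sg.
pose G (z : S * S) := f z.1 * g z.2.
have mG : measurable_fun setT G.
  apply: measurable_funM.
    exact: measurableT_comp sf.1 measurable_fst.
  exact: measurableT_comp sg.1 measurable_snd.
have iG : Q.-integrable setT (EFin \o (fun w => G (Xc r w, Xc (s + t) w))).
  exact: sqint_mul (sqint_Xc r sf) (sqint_Xc (s + t) sg).
set mp := measurable_fun_pair (measurable_Xc r) (measurable_Xc (s + t)).
have iG' : (image_measure Q mp).-integrable setT (EFin \o G).
  by apply: integrable_pushforward => //; exact/measurable_EFinP.
have [_ e] := disint_Rintegral (disint_markov r0 rs t0) iG'.
transitivity (\int[image_measure Q mp]_z G z).
  exact: (@Rintegral_law _ _ _ _ _ Q _ mp (image_measure Q mp)
    (fun _ _ => erefl) G mG).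
rewrite e; apply: eq_Rintegral => w _; rewrite /G /=.
rewrite (Rintegral_scale (kreindex P (measurable_Xc s) w))//.
exact: measurableT_comp sg.1 (measurable_Xc t).
Qed.

(** corr f s g = <f, P_s g>, see corr_Pr.  As an expectation over paths it is
    visibly linear in g and bounded by the product of the norms. *)
Definition corr f s g := dot Q (f \o Xc 0) (g \o Xc s).

Lemma corr0 f g : sqint mu f -> sqint mu g -> corr f 0 g = dot mu f g.
Proof. exact: dot_Xc. Qed.

Lemma corr_Pr f t g : 0 <= t -> sqint mu f -> sqint mu g ->
  corr f t g = dot mu f (Pr t g).
Proof.
move=> t0 sf sg; rewrite /corr -{1}(add0r t) markov_dot//.
by rewrite dot_Xc//; exact: sqint_Pr.
Qed.

Lemma corrD f s t g : 0 <= s -> 0 <= t -> sqint mu f -> sqint mu g ->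
  corr f (s + t) g = corr f s (Pr t g).
Proof. by move=> s0 t0 sf sg; exact: markov_dot. Qed.

Lemma corr_stationary f s t g : 0 <= s -> 0 <= t -> sqint mu f -> sqint mu g ->
  dot Q (f \o Xc s) (g \o Xc (s + t)) = corr f t g.
Proof.
move=> s0 t0 sf sg; rewrite markov_dot// corr_Pr//.
by rewrite dot_Xc//; exact: sqint_Pr.
Qed.

Lemma corr_le f s g : sqint mu f -> sqint mu g ->
  `|corr f s g| <= nrm mu f * nrm mu g.
Proof.
move=> sf sg; rewrite -(nrm_Xc 0 sf) -(nrm_Xc s sg).
by apply: cauchy_schwarz; exact: sqint_Xc.
Qed.

Lemma nrm_Pr_le s g : 0 <= s -> sqint mu g -> nrm mu (Pr s g) <= nrm mu g.
Proof.
move=> s0 sg; have sP := sqint_Pr s sg.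
apply: nrm_le_dual; first exact: nrm_ge0.
by rewrite -corr_Pr// (le_trans (ler_norm _))// corr_le.
Qed.

Lemma corrBr f s g h : sqint mu f -> sqint mu g -> sqint mu h ->
  corr f s (fun x => g x - h x) = corr f s g - corr f s h.
Proof.
move=> sf sg sh; rewrite /corr !(dotC _ (f \o _)) -dotBl//; exact: sqint_Xc.
Qed.

Lemma corrZr f s r g : sqint mu f -> sqint mu g ->
  corr f s (fun x => r * g x) = r * corr f s g.
Proof.
move=> sf sg; rewrite /corr !(dotC _ (f \o _)) -dotZl//; exact: sqint_Xc.
Qed.

Section path_integral.
Context (g : S -> R) (sg : sqint mu g).

Let F (z : measurableTypeR R * Omega) := g (Xc z.1 z.2).

Let mF : measurable_fun setT F.
Proof. exact: measurableT_comp sg.1 jointly_measurable_Xc. Qed.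

Let F_bound u : (\int[Q]_w (F (u, w) ^+ 2)%:E <= (dot mu g g)%:E)%E.
Proof. by rewrite -(dot_Xc u)// (EFin_dot (sqint_Xc u sg)). Qed.

Definition pathint t w : R := \int[window 0 t]_u g (Xc u w).

Lemma sqint_pathint t : sqint Q (pathint t).
Proof. exact: (sqint_integral_family (window 0 t) mF F_bound). Qed.

Lemma bounded_measurable_dot_path (h : Omega -> R) : sqint Q h ->
  bounded_measurable (fun u => dot Q h (g \o Xc u)).
Proof.
move=> sh; split.
  have [i _] := dot_integral_family (window 0 0) mF F_bound sh.
  by apply/measurable_EFinP; exact: measurable_int i.
exists (nrm Q h * nrm mu g) => u; rewrite -(nrm_Xc u sg).
by apply: cauchy_schwarz => //; exact: sqint_Xc.
Qed.

Lemma dot_pathint t (h : Omega -> R) : sqint Q h ->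
  dot Q h (pathint t) = tint 0 t (fun u => dot Q h (g \o Xc u)).
Proof.
move=> sh; have [_ ->] := dot_integral_family (window 0 t) mF F_bound sh.
by rewrite Rintegral_window//; case: (bounded_measurable_dot_path sh).
Qed.

End path_integral.

Lemma bounded_measurable_corr f g : sqint mu f -> sqint mu g ->
  bounded_measurable (fun u => corr f u g).
Proof.
by move=> sf sg; apply: bounded_measurable_dot_path => //; exact: sqint_Xc.
Qed.

Section integrated_semigroup.
Context (g : S -> R) (sg : sqint mu g).

Let mP : measurable_fun setT (fun z : measurableTypeR R * S => Pr z.1 g z.2).
Proof.
pose k := kreindex P
  (measurable_snd : measurable_fun setT (@snd (measurableTypeR R) S)).
pose phi (z : measurableTypeR R * S) (w : Omega) := (z.1, w).
apply: (@measurable_family_Rintegral _ _ _ _ _ k _ _ phi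
  (fun z : measurableTypeR R * Omega => g (Xc z.1 z.2))).
  move=> F F0 mF.
  apply: (measurable_fun_integral_finite_kernel
    (fun z => F (z.1.1, z.2)) k) => //.
  apply: measurableT_comp => //; apply: measurable_fun_pair => //.
  exact: measurableT_comp measurable_fst measurable_fst.
exact: measurableT_comp sg.1 jointly_measurable_Xc.
Qed.

Let PrXc_bound s u :
  (\int[Q]_w ((Pr u g (Xc s w)) ^+ 2)%:E <= (dot mu g g)%:E)%E.
Proof.
have u0 : 0 <= Num.max 0 u by rewrite le_max lexx.
have E : Pr u g = Pr (Num.max 0 u) g.
  by apply/funext => x; rewrite /Pr; apply: eq_Rintegral => w _;
    rewrite /Xc maxA maxxx.
have sP := sqint_Pr (Num.max 0 u) sg.
have := nrm_Pr_le u0 sg; rewrite E -(nrm_Xc s sP) => le.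
rewrite -(EFin_dot (sqint_Xc s sP)) lee_fin -!nrm2.
by rewrite ler_sqr ?nnegrE ?nrm_ge0.
Qed.

(** A_t g = int_0^t P_u g du. *)
Definition Ar t x : R := \int[window 0 t]_u Pr u g x.

Let mPX s : measurable_fun setT
  (fun z : measurableTypeR R * Omega => Pr z.1 g (Xc s z.2)).
Proof.
apply: (measurableT_comp mP
  (g := fun z : measurableTypeR R * Omega => (z.1, Xc s z.2))).
apply: measurable_fun_pair => //.
exact: measurableT_comp (measurable_Xc s) measurable_snd.
Qed.

Lemma sqint_Ar t : sqint mu (Ar t).
Proof.
apply: (sqint_integral_family (window 0 t) mP (M := dot mu g g)) => u.
have mPu := sqint_Pr u sg.
have sq0 x : (0 <= (Pr u g x ^+ 2)%:E)%E by rewrite lee_fin sqr_ge0.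
have := PrXc_bound 0 u.
rewrite (integral_law (measurable_Xc 0) (law_Xc 0)
  (F := fun x => (Pr u g x ^+ 2)%:E))//.
by apply/measurable_EFinP; apply: measurable_funX; exact: mPu.1.
Qed.

(** P_s A_t = int_0^t P_(s+u) du, in weak form. *)
Lemma corr_Ar f s t : 0 <= s -> sqint mu f ->
  corr f s (Ar t) = tint 0 t (fun u => corr f (s + u) g).
Proof.
move=> s0 sf; have sf0 := sqint_Xc 0 sf.
have [i e] := dot_integral_family (window 0 t) (mPX s) (PrXc_bound s) sf0.
have /measurable_EFinP mi := measurable_int _ i.
rewrite {1}/corr e (Rintegral_window 0 t mi).
apply: eq_tint => u /andP[u0 _].
by rewrite -[LHS]/(corr f s (Pr u g)) -corrD.
Qed.

Lemma dot_Ar f t : sqint mu f ->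
  dot mu f (Ar t) = tint 0 t (fun u => corr f u g).
Proof.
move=> sf; rewrite -corr0//; last exact: sqint_Ar.
rewrite (corr_Ar t (lexx 0) sf); apply: eq_tint => u _.
by rewrite add0r.
Qed.

End integrated_semigroup.

(** * The generator and the integrated semigroup *)

(** Strong continuity and the graph of the generator on real functions, with
    the limits at 0 written out. *)
Definition real_strongly_continuous := forall g, sqint mu g ->
  forall e, 0 < e ->
  exists2 a, 0 < a & forall v, 0 <= v <= a ->
    nrm mu (fun x => Pr v g x - g x) <= e.

Definition real_generator f h := [/\ sqint mu f, sqint mu h & forall e, 0 < e ->
  exists2 a, 0 < a & forall v, 0 < v <= a ->
    nrm mu (fun x => v^-1 * (Pr v f x - f x) - h x) <= e].

Hypothesis hsc : real_strongly_continuous.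

(** P_(s+v) f - P_s f = P_s (P_v f - f), and P_s is a contraction: strong
    continuity at 0 is uniform in s. *)
Lemma tint_corr_near k f s a e : 0 <= s -> 0 <= a -> sqint mu k -> sqint mu f ->
  (forall v, 0 <= v <= a -> nrm mu (fun x => Pr v f x - f x) <= e) ->
  `|tint s (s + a) (fun u => corr k u f) - a * corr k s f| <=
    a * (nrm mu k * e).
Proof.
move=> s0 a0 sk sf H; have bk := bounded_measurable_corr sk sf.
rewrite (_ : a * corr k s f = tint s (s + a) (fun=> corr k s f)); last first.
  by rewrite tint_cst ?lerDl// addrAC subrr add0r mulrC.
rewrite -tintB//; last exact: bounded_measurable_cst.
rewrite [leRHS](_ : _ = nrm mu k * e * (s + a - s)); last by ring.
apply: tint_bound; rewrite ?lerDl//.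
  apply: bounded_measurableB => //; exact: bounded_measurable_cst.
move=> x /andP[sx xa].
have v0 : 0 <= x - s by rewrite subr_ge0.
have sP := sqint_Pr (x - s) sf.
rewrite (_ : corr k x f = corr k s (Pr (x - s) f)); last first.
  by rewrite -corrD// addrC subrK.
rewrite -corrBr//; apply: le_trans (corr_le _ sk (sqintB sP sf)) _.
by rewrite ler_wpM2l ?nrm_ge0// H// v0 lerBlDl.
Qed.

(** Shifting the window [0, s] by a replaces its first piece [0, a] by the piece
    [s, s + a]; the integrands there are close to their values at 0 and s. *)
Lemma tint_corr_shift k f s a e : 0 <= s -> 0 <= a ->
  sqint mu k -> sqint mu f ->
  (forall v, 0 <= v <= a -> nrm mu (fun x => Pr v f x - f x) <= e) ->
  `|tint 0 s (fun u => corr k (u + a) f) - tint 0 s (fun u => corr k u f)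
    - a * (corr k s f - corr k 0 f)| <= a * (2 * nrm mu k * e).
Proof.
move=> s0 a0 sk sf H; have bk := bounded_measurable_corr sk sf.
have h1 := tint_corr_near s0 a0 sk sf H.
have := tint_corr_near (lexx 0) a0 sk sf H; rewrite add0r => h0.
rewrite (tint_shift 0 s a bk) add0r.
have sa : s <= s + a by rewrite lerDl.
have as' : a <= s + a by rewrite lerDr.
have e1 := tint_cat bk s0 sa; have e2 := tint_cat bk a0 as'.
have -> : tint a (s + a) (fun u => corr k u f) - tint 0 s (fun u => corr k u f)
    - a * (corr k s f - corr k 0 f) =
  (tint s (s + a) (fun u => corr k u f) - a * corr k s f)
  - (tint 0 a (fun u => corr k u f) - a * corr k 0 f).
  by move: e1; rewrite e2; set x := tint _ _ _; set y := tint _ _ _; lra.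
apply: (le_trans (ler_normB _ _)); apply: (le_trans (lerD h1 h0)).
by rewrite -mulrDr -mulrDl -mulr2n mulr_natl.
Qed.

(** L (A_t g) = P_t g - g: by corr_Ar the difference quotient of A_t g is the
    shift of tint_corr_shift divided by its length. *)
Lemma real_generator_Ar t g : 0 <= t -> sqint mu g ->
  real_generator (Ar g t) (fun x => Pr t g x - g x).
Proof.
move=> t0 sg; have sA := sqint_Ar sg t; have sP := sqint_Pr t sg.
split => //; first exact: sqintB.
move=> e e0; have e20 : 0 < e / 2 by lra.
have [a a0 H] := hsc sg e20; exists a => // v /andP[v0 va].
have sPA := sqint_Pr v sA.
set u := (fun x => _); have su : sqint mu u.
  by apply: sqintB; [apply: sqintZ|]; exact: sqintB.
apply: nrm_le_dual; first exact: ltW.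
have v0' := ltW v0.
have sPB : sqint mu (fun x => Pr v (Ar g t) x - Ar g t x) by exact: sqintB.
have sgB : sqint mu (fun x => Pr t g x - g x) by exact: sqintB.
have E : dot mu u u = v^-1 * (corr u v (Ar g t) - dot mu u (Ar g t)) -
    (corr u t g - corr u 0 g).
  rewrite {2}/u (dotBr (sqintZ v^-1 sPB) sgB su) dotZr// !dotBr//.
  by rewrite -!corr_Pr ?corr0.
have K := @tint_corr_shift u g t v (e / 2) t0 v0' su sg.
have {}K : `|v * dot mu u u| <= v * (nrm mu u * e).
  have -> : v * (nrm mu u * e) = v * (2 * nrm mu u * (e / 2)) by field.
  apply: le_trans (K _); last first.
    by move=> w /andP[w0 wv]; apply: H; rewrite w0 (le_trans wv).
  rewrite E corr_Ar// dot_Ar// mulrBr mulrA divff ?gt_eqF// mul1r.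
  rewrite (@eq_tint _ _ _ (fun w => corr u (v + w) g)
    (fun w => corr u (w + v) g))//.
  by move=> x _; rewrite addrC.
by move: K; rewrite normrM gtr0_norm// ler_pM2l// => /(le_trans (ler_norm _)).
Qed.

(** A_s (L f) = P_s f - f, in weak form: A_s is bounded, and its value at the
    difference quotient of f is again the shift of tint_corr_shift. *)
Lemma Ar_generator k f h s : 0 <= s -> sqint mu k -> real_generator f h ->
  dot mu k (Ar h s) = corr k s f - dot mu k f.
Proof.
move=> s0 sk [sf sh H]; rewrite -(corr0 sk sf).
apply/eqP; rewrite -subr_eq0 -normr_le0; set D := (`|_|).
have K0 : 0 <= s * nrm mu k + 2 * nrm mu k.
  by rewrite addr_ge0// mulr_ge0 ?nrm_ge0.
have le eta : 0 < eta -> D <= (s * nrm mu k + 2 * nrm mu k) * eta.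
  move=> eta0; have [a1 a10 H1] := hsc sf eta0; have [a2 a20 H2] := H _ eta0.
  pose a := Num.min a1 a2.
  have a0 : 0 < a by rewrite lt_min a10.
  have a0' := ltW a0.
  have aa1 : a <= a1 by rewrite ge_min lexx.
  have aa2 : a <= a2 by rewrite ge_min lexx orbT.
  have sP := sqint_Pr a sf.
  have sPB : sqint mu (fun x => Pr a f x - f x) by exact: sqintB.
  pose w x := a^-1 * (Pr a f x - f x) - h x.
  have sw : sqint mu w by apply: sqintB => //; exact: sqintZ.
  have nw : nrm mu w <= eta by apply: H2; rewrite a0.
  have wE : tint 0 s (fun u => corr k u w) =
      a^-1 * (tint 0 s (fun u => corr k (u + a) f) -
              tint 0 s (fun u => corr k u f)) - dot mu k (Ar h s).
    have bk := bounded_measurable_corr sk sf.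
    have bk' : bounded_measurable (fun u => corr k (u + a) f).
      by apply: (bounded_measurable_comp _ bk); exact: measurable_funD.
    have bkd := bounded_measurableB bk' bk.
    have bh := bounded_measurable_corr sk sh.
    rewrite dot_Ar// -tintB// -tintZ// -tintB//; last first.
      by apply: bounded_measurableZ.
    apply: eq_tint => u /andP[u0 _].
    rewrite corrBr//; last exact: sqintZ.
    by rewrite corrZr// corrBr// -corrD.
  have B1 : `|tint 0 s (fun u => corr k u w)| <= nrm mu k * eta * (s - 0).
    apply: tint_bound => //; first exact: bounded_measurable_corr.
    move=> x _; apply: le_trans (corr_le _ sk sw) _.
    by rewrite ler_wpM2l ?nrm_ge0.
  have B2 := @tint_corr_shift k f s a eta s0 a0' sk sf.
  have {}B2 : `|a^-1 * (tint 0 s (fun u => corr k (u + a) f) -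
      tint 0 s (fun u => corr k u f)) - (corr k s f - corr k 0 f)| <=
      2 * nrm mu k * eta.
    rewrite -(ler_pM2l a0) -{1}(gtr0_norm a0) -normrM mulrBr mulVKf ?gt_eqF//.
    by apply: B2 => v /andP[v0 va]; apply: H1; rewrite v0 (le_trans va).
  move: B1 B2; rewrite wE subr0 /D.
  set x := a^-1 * _; set y := dot _ _ _; set z := corr _ _ _ - corr _ _ _.
  move=> B1 B2.
  apply: (le_trans (ler_distD x _ _)); rewrite (distrC y).
  apply: (le_trans (lerD B1 B2)).
  by rewrite le_eqVlt; apply/orP; left; apply/eqP; ring.
have [//|D0] := leP D 0.
set K := _ + _ in K0 le.
have K1 : 0 < 2 * (K + 1) by lra.
have := le _ (divr_gt0 D0 K1).
rewrite mulrCA -[leLHS]mulr1 ler_pM2l// ler_pdivlMr// mul1r => ?.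
by exfalso; lra.
Qed.

Lemma corr_cst s g : sqint mu g -> corr (cst 1) s g = dot mu (cst 1) g.
Proof. by move=> sg; rewrite -(dot_Xc s (sqint_cst mu 1) sg). Qed.

Lemma mean0_Ar t g : sqint mu g -> dot mu (cst 1) g = 0 ->
  0 <= t -> dot mu (cst 1) (Ar g t) = 0.
Proof.
move=> sg g0 t0; rewrite dot_Ar//; last exact: sqint_cst.
rewrite (@eq_tint _ _ _ _ (fun=> 0)); last by move=> u _; rewrite corr_cst.
by rewrite tint_cst// mul0r.
Qed.

(** Stationarity makes the mean of P_t f constant in t. *)
Lemma mean0_generator f h : real_generator f h -> dot mu (cst 1) h = 0.
Proof.
move=> fh; have [sf sh _] := fh; have s1 := sqint_cst mu (1 : R).
have := Ar_generator ler01 s1 fh; rewrite corr_cst// subrr.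
rewrite dot_Ar// (@eq_tint _ _ _ _ (fun=> dot mu (cst 1) h)); last first.
  by move=> u _; rewrite corr_cst.
by rewrite tint_cst ?ler01// subr0 mulr1.
Qed.

(** A_t g is the conditional expectation of the path integral given X_0. *)
Lemma nrm_Ar_le_pathint t g : sqint mu g ->
  nrm mu (Ar g t) <= nrm Q (pathint g t).
Proof.
move=> sg; have sA := sqint_Ar sg t; have sY := sqint_pathint sg t.
have sA0 := sqint_Xc 0 sA.
apply: nrm_le_dual; first exact: nrm_ge0.
rewrite {1}dot_Ar//.
rewrite -[X in X <= _]/(tint 0 t
  (fun u => dot Q (Ar g t \o Xc 0) (g \o Xc u))).
rewrite -dot_pathint// (le_trans (ler_norm _))//.
by rewrite -(nrm_Xc 0 sA); exact: cauchy_schwarz.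
Qed.

(** E[g(X_u) g(X_v)] depends on |u - v| only.  The times v before u contribute
    <g, A_u g>, those after u contribute <g, A_(t-u) g>. *)
Lemma dot_pathint_Xc t u g : 0 <= u -> u <= t -> sqint mu g ->
  dot Q (pathint g t) (g \o Xc u) =
  dot mu g (Ar g u) + dot mu g (Ar g (t - u)).
Proof.
move=> u0 ut sg; have su := sqint_Xc u sg.
have bc := bounded_measurable_corr sg sg.
have bp : bounded_measurable (fun v => dot Q (g \o Xc u) (g \o Xc v)).
  exact: bounded_measurable_dot_path.
have E1 : tint 0 u (fun v => dot Q (g \o Xc u) (g \o Xc v)) =
    tint 0 u (fun v => corr g v g).
  transitivity (tint 0 u (fun v => corr g (u - v) g)).
    apply: eq_tint => v /andP[v0 vu].
    have uv0 : 0 <= u - v by rewrite subr_ge0.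
    by rewrite dotC -(corr_stationary v0 uv0 sg sg) addrC subrK.
  by rewrite (tint_reflect 0 u u bc) subrr subr0.
have E2 : tint u t (fun v => dot Q (g \o Xc u) (g \o Xc v)) =
    tint 0 (t - u) (fun v => corr g v g).
  transitivity (tint u t (fun v => corr g (v + - u) g)).
    apply: eq_tint => v /andP[uv vt].
    have uv0 : 0 <= v - u by rewrite subr_ge0.
    by rewrite -(corr_stationary u0 uv0 sg sg) addrC subrK.
  by rewrite (tint_shift u t (- u) bc) subrr.
rewrite dotC (dot_pathint sg t su) (tint_cat bp u0 ut) E1 E2.
by rewrite (dot_Ar sg u sg) (dot_Ar sg (t - u) sg).
Qed.

(** * Bounds on the path integral *)

Section bounds.
Context (t : R) (t0 : 0 < t).

(** The gap is only ever applied to A_u g, whose image under L is P_u g - g. *)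
Lemma variance_upper c : 0 < c ->
  (forall f h, real_generator f h -> dot mu (cst 1) f = 0 ->
    c * nrm mu f <= nrm mu h) ->
  forall g, sqint mu g -> dot mu (cst 1) g = 0 ->
  dot Q (pathint g t) (pathint g t) <= t * (4 / c * dot mu g g).
Proof.
move=> c0 gap g sg g0.
have Ale u : 0 <= u -> dot mu g (Ar g u) <= 2 / c * dot mu g g.
  move=> u0; have sA := sqint_Ar sg u; have sP := sqint_Pr u sg.
  have := gap _ _ (real_generator_Ar u0 sg) (mean0_Ar sg g0 u0).
  have := nrmB_le sP sg; have := nrm_Pr_le u0 sg => h1 h2 h3.
  have h4 : nrm mu (Ar g u) <= 2 / c * nrm mu g.
    rewrite mulrAC ler_pdivlMr// mulrC; apply: (le_trans h3); lra.
  apply: (le_trans (ler_norm _)); apply: (le_trans (cauchy_schwarz sg sA)).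
  by rewrite -nrm2 expr2 mulrCA ler_wpM2l// nrm_ge0.
have sY := sqint_pathint sg t.
rewrite dot_pathint//.
have bp : bounded_measurable (fun u => dot Q (pathint g t) (g \o Xc u)).
  exact: bounded_measurable_dot_path.
rewrite mulrC -[X in _ * X]subr0 -tint_cst ?(ltW t0)//.
apply: le_tint => //; first exact: bounded_measurable_cst.
move=> u /andP[u0 ut]; rewrite dot_pathint_Xc//.
have h1 := Ale _ u0; have h2 : dot mu g (Ar g (t - u)) <= 2 / c * dot mu g g.
  by apply: Ale; rewrite subr_ge0.
apply: (le_trans (lerD h1 h2)).
by rewrite -mulrDl -mulrDl -natrD.
Qed.

(** Integrate f = P_s f - A_s h, tested against f, over s in [t, 2t]. *)
Lemma variance_lower f h r D : real_generator f h -> dot mu (cst 1) f = 0 ->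
  0 < nrm mu f -> nrm mu h <= r * nrm mu f -> 0 <= D ->
  (forall s g, t <= s <= 2 * t -> sqint mu g -> dot mu (cst 1) g = 0 ->
     nrm Q (pathint g s) <= s * D * nrm mu g) ->
  1 <= D * (3 / 2 * r * t + 3).
Proof.
move=> fh f0 nf0 hr D0 H; have [sf sh _] := fh; have h0 := mean0_generator fh.
have bc := bounded_measurable_corr sf sf.
have t0' := ltW t0; have tt : t <= 2 * t by lra.
have HA s g : t <= s <= 2 * t -> sqint mu g -> dot mu (cst 1) g = 0 ->
    nrm mu (Ar g s) <= s * D * nrm mu g.
  by move=> ts sg g0; apply: le_trans (nrm_Ar_le_pathint s sg) (H s g ts sg g0).
have r0 : 0 <= r.
  by rewrite -(pmulr_lge0 _ nf0) (le_trans (nrm_ge0 _ _) hr).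
have ff : dot mu f f = nrm mu f ^+ 2 by rewrite nrm2.
(* P_s f stays close to f, because its increment is A_s h *)
have low : tint t (2 * t) (fun s => dot mu f f - corr f s f) <=
    (D * r * nrm mu f ^+ 2) * (((2 * t) ^+ 2 - t ^+ 2) / 2).
  apply: tint_le_linear => //.
    by apply: bounded_measurableB => //; exact: bounded_measurable_cst.
  move=> s /andP[ts s2].
  have s0 : 0 <= s by rewrite (le_trans t0').
  rewrite -opprB -(Ar_generator s0 sf fh).
  apply: (le_trans (ler_norm _)); rewrite normrN.
  apply: (le_trans (cauchy_schwarz sf (sqint_Ar sh s))).
  have := HA s h; rewrite ts s2 => /(_ isT sh h0) hA.
  have hA' : nrm mu (Ar h s) <= s * D * (r * nrm mu f).
    by apply: (le_trans hA); rewrite ler_wpM2l// mulr_ge0.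
  rewrite (_ : D * _ * _ * s = nrm mu f * (s * D * (r * nrm mu f))).
    by rewrite ler_wpM2l// nrm_ge0.
  by ring.
(* the average of P_s f over [t, 2t] is small *)
have up : tint t (2 * t) (fun s => corr f s f) <= 3 * t * D * nrm mu f ^+ 2.
  have e := tint_cat bc t0' tt.
  rewrite -(dot_Ar sf (2 * t) sf) -(dot_Ar sf t sf) in e.
  have -> : tint t (2 * t) (fun s => corr f s f) =
     dot mu f (Ar f (2 * t)) - dot mu f (Ar f t) by rewrite e addrC addKr.
  have A2 := HA (2 * t) f; rewrite tt lexx in A2.
  have {}A2 := A2 isT sf f0.
  have A1 := HA t f; rewrite lexx tt in A1; have {}A1 := A1 isT sf f0.
  have F0 := ltW nf0.
  apply: difference_le (ler_wpM2l F0 A2) (ler_wpM2l F0 A1) _ _.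
    exact: cauchy_schwarz sf (sqint_Ar sf t).
  exact: cauchy_schwarz sf (sqint_Ar sf (2 * t)).
have bcst := bounded_measurable_cst (dot mu f f).
rewrite (tintB _ _ bcst bc) (tint_cst _ tt) ff in low.
have F2 : 0 < nrm mu f ^+ 2 by rewrite exprn_gt0.
exact: average_bound t0 F2 up low.
Qed.

End bounds.
End stationary_process.

(** * Norms of complex-valued functions *)

Section convergence_at_right.
Context (R : realType).

Lemma cvg_right0_le (F : R -> \bar R) : F t @[t --> 0^'+] --> 0%E ->
  forall e, 0 < e -> exists2 a, 0 < a & forall v, 0 < v <= a -> (F v <= e%:E)%E.
Proof.
move=> /fine_cvgP[Ffin /cvgrPdist_le F0] e e0.
have Fe := F0 e e0.
have : nbhs (0 : R)
    (fun v => 0 < v -> F v \is a fin_num /\ `|0 - fine (F v)| <= e).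
  exact: filterI Ffin Fe.
move=> /nbhs_ballP[a a0 H].
exists (a / 2); first by rewrite divr_gt0.
move=> v /andP[v0 va].
have av : ball (0 : R) a v.
  by rewrite /ball/= sub0r normrN gtr0_norm//; have : 0 < a by []; lra.
have [Fv] := H v av v0.
rewrite /= sub0r normrN => h.
by rewrite -(fineK Fv) lee_fin (le_trans (ler_norm _)).
Qed.

Lemma le_cvg_right0 (G : R -> R) :
  (forall e, 0 < e -> exists2 a, 0 < a & forall v, 0 < v <= a -> `|G v| <= e) ->
  (G t)%:E @[t --> 0^'+] --> 0%E.
Proof.
move=> H; apply: cvg_EFin; first by apply: nearW.
apply/cvgrPdist_le => e e0; have [a a0 Ha] := H e e0.
have : nbhs (0 : R) (fun v => 0 < v -> `|0 - G v| <= e); last by [].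
apply/nbhs_ballP; exists a => // v /=; rewrite /ball/= sub0r normrN => va v0.
by rewrite sub0r normrN; apply: Ha; rewrite v0 -(gtr0_norm v0) ltW.
Qed.

End convergence_at_right.

Section complex_norm.
Context d (T : measurableType d) (R : realType).
Context (m : {finite_measure set T -> \bar R}).
Implicit Types f : T -> R[i].

Definition repart f x : R := complex.Re (f x).
Definition impart f x : R := complex.Im (f x).

Definition nrmC f : R :=
  Num.sqrt (dot m (repart f) (repart f) + dot m (impart f) (impart f)).

Lemma normc_sqr (z : R[i]) :
  ComplexField.Normc.normc z ^+ 2 = complex.Re z ^+ 2 + complex.Im z ^+ 2.
Proof. by case: z => a b; rewrite /= sqr_sqrtr// addr_ge0// sqr_ge0. Qed.

Lemma normc_ge0 (z : R[i]) : 0 <= ComplexField.Normc.normc z.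
Proof. by case: z => a b; rewrite /= sqrtr_ge0. Qed.

Lemma integral_normc_sqr f : cmeasurable f ->
  (\int[m]_x (ComplexField.Normc.normc (f x) ^+ 2)%:E =
   \int[m]_x (repart f x ^+ 2)%:E + \int[m]_x (impart f x ^+ 2)%:E)%E.
Proof.
move=> [mr mi]; rewrite -ge0_integralD//.
- by apply: eq_integral => x _; rewrite normc_sqr EFinD.
- by move=> x _; rewrite lee_fin sqr_ge0.
- by apply/measurable_EFinP; exact: measurable_funX.
- by move=> x _; rewrite lee_fin sqr_ge0.
- by apply/measurable_EFinP; exact: measurable_funX.
Qed.

Lemma L2norm_sqrte f :
  L2norm m f = sqrte (\int[m]_x (ComplexField.Normc.normc (f x) ^+ 2)%:E)%E.
Proof.
rewrite /L2norm unlock poweR12_sqrt; last first.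
  by apply: integral_ge0 => x _; exact: poweR_ge0.
congr sqrte; apply: eq_integral => x _ /=.
by rewrite ger0_norm ?normc_ge0// powR_mulrn// normc_ge0.
Qed.

Lemma L2P f : L2 m f <-> sqint m (repart f) /\ sqint m (impart f).
Proof.
have ge0 (u : T -> R) : (0 <= \int[m]_x (u x ^+ 2)%:E)%E.
  by apply: integral_ge0 => x _; rewrite lee_fin sqr_ge0.
have r0 := ge0 (repart f); have i0 := ge0 (impart f).
split.
  move=> [mf]; have [mr mi] := mf.
  have lt (x : \bar R) : (sqrte x < +oo -> x < +oo)%E.
    by case: x => //= r _; rewrite ltry.
  rewrite L2norm_sqrte integral_normc_sqr// => /lt lty.
  split; split => //; apply: le_lt_trans lty.
    exact: leeDl.
  exact: leeDr.
move=> [[mr r2] [mi i2]]; split => //.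
rewrite L2norm_sqrte integral_normc_sqr//.
have : (\int[m]_x (repart f x ^+ 2)%:E +
    \int[m]_x (impart f x ^+ 2)%:E < +oo)%E.
  exact: lte_add_pinfty.
by case: (_ + _)%E => [a| |]//= _; rewrite ltry.
Qed.

Lemma L2norm_fin f : sqint m (repart f) -> sqint m (impart f) ->
  L2norm m f = (nrmC f)%:E.
Proof.
move=> sr si; rewrite L2norm_sqrte integral_normc_sqr; last first.
  by split; [exact: sr.1|exact: si.1].
by rewrite -(EFin_dot sr) -(EFin_dot si).
Qed.

Lemma nrmC_ge0 f : 0 <= nrmC f. Proof. exact: sqrtr_ge0. Qed.

Lemma nrmC_sqr f : nrmC f ^+ 2 = nrm m (repart f) ^+ 2 + nrm m (impart f) ^+ 2.
Proof. by rewrite sqr_sqrtr ?addr_ge0 ?dot_ge0// !nrm2. Qed.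

Lemma nrm_repart_le f : nrm m (repart f) <= nrmC f.
Proof.
by rewrite -ler_sqr ?nnegrE ?nrm_ge0 ?nrmC_ge0// nrmC_sqr lerDl sqr_ge0.
Qed.

Lemma nrm_impart_le f : nrm m (impart f) <= nrmC f.
Proof.
by rewrite -ler_sqr ?nnegrE ?nrm_ge0 ?nrmC_ge0// nrmC_sqr lerDr sqr_ge0.
Qed.

Definition ofreal (u : T -> R) : T -> R[i] := fun x => (u x +i* 0)%C.

Lemma sqint_ofreal u : sqint m u -> L2 m (ofreal u).
Proof.
by move=> su; apply/L2P; split => //; exact: (sqint_cst m (0 : R)).
Qed.

Lemma L2norm_ofreal u : sqint m u -> L2norm m (ofreal u) = (nrm m u)%:E.
Proof.
move=> su; rewrite L2norm_fin//; last exact: (sqint_cst m (0 : R)).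
congr (_%:E); rewrite /nrmC (_ : dot m (impart _) _ = 0) ?addr0//.
rewrite /dot; under eq_Rintegral do rewrite mul0r.
by rewrite Rintegral_cst// mul0r.
Qed.

Lemma cintegral_eq0 f : sqint m (repart f) -> sqint m (impart f) ->
  cintegral m setT f = 0 <->
  dot m (cst 1) (repart f) = 0 /\ dot m (cst 1) (impart f) = 0.
Proof.
move=> sr si; rewrite /cintegral /dot.
under [X in X = 0 /\ _]eq_Rintegral do rewrite mul1r.
under [X in _ /\ X = 0]eq_Rintegral do rewrite mul1r.
by split => [[-> ->]//|[]]; rewrite /repart /impart => -> ->.
Qed.

Lemma nrm_eq0_ae u : sqint m u -> {ae m, forall x, u x = 0} -> nrm m u = 0.
Proof.
move=> su u0; rewrite /nrm (_ : dot m u u = 0) ?sqrtr0//.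
rewrite /dot /Rintegral (ae_eq_integral (cst 0%E))//.
  by rewrite integral0.
  by apply/measurable_EFinP; apply: measurable_funM; exact: su.1.
by apply: filterS u0 => x + _ => ->; rewrite mulr0.
Qed.

Lemma nrm_eq0_ae_inv u : sqint m u -> nrm m u = 0 -> {ae m, forall x, u x = 0}.
Proof.
move=> su /eqP; rewrite sqrtr_eq0 => u0.
have {}u0 : dot m u u = 0 by apply/eqP; rewrite eq_le u0 dot_ge0.
have mu2 : measurable_fun setT (fun x => (u x ^+ 2)%:E).
  by apply/measurable_EFinP; apply: measurable_funX; exact: su.1.
have := EFin_dot su; rewrite u0 => /esym.
have -> : (\int[m]_x (u x ^+ 2)%:E = \int[m]_x `|(u x ^+ 2)%:E|)%E.
  by apply: eq_integral => x _; rewrite gee0_abs// lee_fin sqr_ge0.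
move=> /(ae_eq_integral_abs _ measurableT mu2).
apply: filterS => x /(_ I) /= [] /eqP; rewrite sqrf_eq0 => /eqP //.
Qed.

End complex_norm.

(** * From complex to real functions *)

Section transfer.
Context (R : realType) (d d' : measure_display).
Context (S : measurableType d) (Omega : measurableType d').
Context (P : R.-pker S ~> Omega) (X : R -> Omega -> S) (mu : probability S R).
Hypothesis hX : markov_process P X.
Hypothesis hmu : invariant_measure P X mu.

Let Q : probability Omega R := Pmu P mu.

Lemma semigroup_Pr t (g : S -> R[i]) : 0 <= t -> forall x,
  semigroup P X t g x = (Pr P X t (repart g) x +i* Pr P X t (impart g) x)%C.
Proof. by move=> t0 x; rewrite /semigroup /cintegral /Pr Xc_ge0. Qed.

Lemma Pr0 t x : Pr P X t (cst 0) x = 0.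
Proof. by rewrite /Pr Rintegral_cst// mul0r. Qed.

Lemma strongly_continuous_real :
  strongly_continuous P X mu -> real_strongly_continuous P X mu.
Proof.
move=> hP g sg e e0; have sgC := sqint_ofreal sg.
have [a a0 H] := cvg_right0_le (hP _ sgC) e0.
exists a => // v /andP[v0 va].
have sP := sqint_Pr hX hmu v sg; have sB := sqintB sP sg.
have [v00|vgt0] := eqVneq v 0.
  rewrite v00 in sP sB *; apply: le_trans (ltW e0).
  apply: nrm_le_dual => //; rewrite mulr0 (dotBr sP sg sB).
  by rewrite -(corr_Pr hX hmu (lexx 0) sB sg) (corr0 hX hmu sB sg) subrr.
have {}vgt0 : 0 < v by rewrite lt_def vgt0.
have := H v; rewrite vgt0 va => /(_ isT).
rewrite (_ : (fun x => _) = ofreal (fun x => Pr P X v g x - g x)).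
  by rewrite (L2norm_ofreal sB) lee_fin.
apply/funext => x; rewrite semigroup_Pr// (Pr0 v) /ofreal.
by apply/eqP; rewrite eq_complex /= subr0 !eqxx.
Qed.

Let Re_divr (z : R[i]) (v : R) : complex.Re (z / v%:C%C) = v^-1 * complex.Re z.
Proof.
rewrite -fmorphV; case: z => a b /=; rewrite mulr0 subr0 mulrC //.
Qed.

Let Im_divr (z : R[i]) (v : R) : complex.Im (z / v%:C%C) = v^-1 * complex.Im z.
Proof.
rewrite -fmorphV; case: z => a b /=; rewrite mulr0 add0r mulrC //.
Qed.

Let quotient f h v x := (semigroup P X v f x - f x) / v%:C%C - h x.

Let quotient_re f h v : 0 <= v ->
  repart (quotient f h v) =
  fun x => v^-1 * (Pr P X v (repart f) x - repart f x) - repart h x.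
Proof.
move=> v0; apply/funext => x; rewrite /repart /quotient semigroup_Pr//.
by rewrite raddfB /= Re_divr raddfB.
Qed.

Let quotient_im f h v : 0 <= v ->
  impart (quotient f h v) =
  fun x => v^-1 * (Pr P X v (impart f) x - impart f x) - impart h x.
Proof.
move=> v0; apply/funext => x; rewrite /impart /quotient semigroup_Pr//.
by rewrite raddfB /= Im_divr raddfB.
Qed.

Lemma is_generator_re_im f h : is_generator P X mu f h ->
  real_generator P X mu (repart f) (repart h) /\
  real_generator P X mu (impart f) (impart h).
Proof.
move=> [/L2P[sfr sfi] /L2P[shr shi] H].
have bound e : 0 < e -> exists2 a, 0 < a & forall v, 0 < v <= a ->
    nrmC mu (quotient f h v) <= e.
  move=> e0; have [a a0 Ha] := cvg_right0_le H e0.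
  exists a => // v /andP[v0 va]; have := Ha v; rewrite v0 va => /(_ isT).
  have v0' := ltW v0.
  rewrite -[X in L2norm _ X]/(quotient f h v) L2norm_fin ?lee_fin//.
    rewrite quotient_re//; apply: sqintB => //; apply: sqintZ.
    by apply: sqintB => //; exact: sqint_Pr.
  rewrite quotient_im//; apply: sqintB => //; apply: sqintZ.
  by apply: sqintB => //; exact: sqint_Pr.
split; split => // e e0; have [a a0 Ha] := bound e e0; exists a => // v va.
  rewrite -quotient_re; last by case/andP: va => /ltW.
  exact: le_trans (nrm_repart_le _ _) (Ha v va).
rewrite -quotient_im; last by case/andP: va => /ltW.
exact: le_trans (nrm_impart_le _ _) (Ha v va).
Qed.

(** Real pairs in the graph of L are what the upper bound feeds into gamma. *)
Lemma real_generator_is_generator (f h : S -> R) : real_generator P X mu f h ->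
  is_generator P X mu (ofreal f) (ofreal h).
Proof.
move=> [sf sh H]; split; [exact: sqint_ofreal|exact: sqint_ofreal|].
pose q v x := v^-1 * (Pr P X v f x - f x) - h x.
have sq v : sqint mu (q v).
  by apply: sqintB => //; apply: sqintZ; apply: sqintB => //; exact: sqint_Pr.
have E v : 0 < v -> L2norm mu (fun x =>
    (semigroup P X v (ofreal f) x - ofreal f x) / v%:C%C - ofreal h x) =
    (nrm mu (q v))%:E.
  move=> v0; rewrite -(L2norm_ofreal (sq v)); congr (L2norm mu _).
  apply/funext => x; rewrite -[LHS]/(quotient (ofreal f) (ofreal h) v x).
  have v0' := ltW v0.
  apply/eqP; rewrite eq_complex; apply/andP; split; apply/eqP.
    rewrite -[LHS]/(repart (quotient (ofreal f) (ofreal h) v) x).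
    by rewrite quotient_re.
  rewrite -[LHS]/(impart (quotient (ofreal f) (ofreal h) v) x).
  rewrite quotient_im// (_ : impart (ofreal f) = cst 0)//.
  by rewrite (Pr0 v) /= subrr mulr0 subr0.
have C : (nrm mu (q v))%:E @[v --> 0^'+] --> 0%E.
  apply: le_cvg_right0 => e e0; have [a a0 Ha] := H e e0.
  by exists a => // v va; rewrite ger0_norm ?nrm_ge0//; exact: Ha.
apply: cvg_trans C; apply: near_eq_cvg.
have : nbhs (0 : R) (fun v => 0 < v -> (nrm mu (q v))%:E = L2norm mu (fun x =>
    (semigroup P X v (ofreal f) x - ofreal f x) / v%:C%C - ofreal h x));
  last by [].
apply/nbhs_ballP; exists 1 => //= v _ v0; exact/esym/E.
Qed.

Lemma sv_gap_le (f h : S -> R) c : (c%:E <= sv_gap P X mu)%E ->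
  real_generator P X mu f h -> dot mu (cst 1) f = 0 -> c * nrm mu f <= nrm mu h.
Proof.
move=> cg fh f0; have [sf sh _] := fh.
have [->|nf0] := eqVneq (nrm mu f) 0; first by rewrite mulr0 nrm_ge0.
have nf : 0 < nrm mu f by rewrite lt_def nf0 nrm_ge0.
rewrite -ler_pdivlMr// -lee_fin; apply: le_trans cg _; apply: ereal_inf_lbound.
exists (ofreal f), (ofreal h); split.
- exact: real_generator_is_generator.
- split; first exact: sqint_ofreal.
  apply/cintegral_eq0 => //; first exact: (sqint_cst mu (0 : R)).
  split => //; rewrite /dot; under eq_Rintegral do rewrite mulr0.
  by rewrite Rintegral_cst// mul0r.
- move=> H; move/eqP: nf0; apply; apply: (nrm_eq0_ae sf).
  by apply: filterS H => x /(congr1 (@complex.Re R)).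
- by rewrite !L2norm_ofreal// inver (negbTE nf0) -EFinM.
Qed.

Lemma time_average_parts t g w : 0 < t -> cmeasurable g ->
  complex.Re (time_average X t g w) = t^-1 * pathint X (repart g) t w /\
  complex.Im (time_average X t g w) = t^-1 * pathint X (impart g) t w.
Proof.
move=> t0 [mr mi].
have E (u : S -> R) : measurable_fun setT u ->
    pathint X u t w = \int[lebesgue_measure]_(s in `[0, t]) u (X s w).
  move=> mu'.
  have mX : measurable_fun setT (fun s : measurableTypeR R => u (Xc X s w)).
    have := measurableT_comp (jointly_measurable_Xc hX) (measurable_pair2 w).
    exact: measurableT_comp.
  rewrite /pathint Rintegral_window//.
  by apply: eq_tint => s /andP[s0 _]; rewrite Xc_ge0.
rewrite /time_average !E// /cintegral /=.
by rewrite !mul0r subr0 addr0.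
Qed.

Lemma Var_pathint t g : 0 < t -> L20 mu g ->
  Var P X mu t g = (t^-1 ^+ 2 * (nrm Q (pathint X (repart g) t) ^+ 2 +
                                 nrm Q (pathint X (impart g) t) ^+ 2))%:E.
Proof.
move=> t0 [/L2P[sr si] g0]; rewrite /Var g0.
have sYr := sqint_pathint hX hmu sr t; have sYi := sqint_pathint hX hmu si t.
rewrite !nrm2 EFinM EFinD (EFin_dot sYr) (EFin_dot sYi).
have [mYr _] := sYr; have [mYi _] := sYi.
have mr2 : measurable_fun setT (fun w => (pathint X (repart g) t w ^+ 2)%:E).
  by apply/measurable_EFinP; exact: measurable_funX.
have mi2 : measurable_fun setT (fun w => (pathint X (impart g) t w ^+ 2)%:E).
  by apply/measurable_EFinP; exact: measurable_funX.
rewrite -ge0_integralD//; last 2 first.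
- by move=> w _; rewrite lee_fin sqr_ge0.
- by move=> w _; rewrite lee_fin sqr_ge0.
rewrite -ge0_integralZl//; last 3 first.
- exact: emeasurable_funD.
- by move=> w _; rewrite -EFinD lee_fin addr_ge0// sqr_ge0.
- by rewrite lee_fin sqr_ge0.
apply: eq_integral => w _; rewrite subr0 normc_sqr -EFinD -EFinM.
have [-> ->] := time_average_parts w t0 (conj sr.1 si.1).
by rewrite !exprMn mulrDr.
Qed.

Lemma Delta_ge0 t : (0 <= Delta P X mu t)%E.
Proof. by apply: ereal_sup_ubound; right. Qed.

(** Delta_t only sees functions of norm 1, so g is rescaled; a null g has a null
    path integral. *)
Lemma pathint_le_Delta t D g : 0 < t -> (Delta P X mu t <= D%:E)%E ->
  sqint mu g -> dot mu (cst 1) g = 0 ->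
  nrm Q (pathint X g t) <= t * D * nrm mu g.
Proof.
move=> t0 tD sg g0; have sY := sqint_pathint hX hmu sg t.
have [ng0|ng0] := eqVneq (nrm mu g) 0.
  rewrite ng0 mulr0; apply: nrm_le_dual => //; rewrite mulr0.
  rewrite (dot_pathint hX hmu sg t sY) (@eq_tint _ _ _ _ (fun=> 0)).
    by rewrite (tint_cst _ (ltW t0)) mul0r.
  move=> u _; have su := sqint_Xc hX hmu u sg.
  by rewrite dotC nrm_eq0_dot// nrm_Xc.
have ng : 0 < nrm mu g by rewrite lt_def ng0 nrm_ge0.
pose g' x := (nrm mu g)^-1 * g x.
have sg' : sqint mu g' by exact: sqintZ.
have g'1 : nrm mu g' = 1.
  rewrite /nrm dotZl// dotZr// -nrm2 -[X in Num.sqrt X](_ : 1 = _) ?sqrtr1//.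
  by field.
have L20g : L20 mu (ofreal g').
  split; first exact: sqint_ofreal.
  apply/cintegral_eq0 => //; first exact: (sqint_cst mu (0 : R)).
  split; last by rewrite /dot; under eq_Rintegral do rewrite mulr0;
    rewrite Rintegral_cst// mul0r.
  by rewrite (dotZr _ sg (sqint_cst mu 1)) g0 mulr0.
have VD : (sqrte (Var P X mu t (ofreal g')) <= D%:E)%E.
  apply: le_trans tD; apply: ereal_sup_ubound; left.
  by exists (ofreal g') => //; split => //; rewrite (L2norm_ofreal sg') g'1.
have D0 : 0 <= D by rewrite -lee_fin (le_trans (Delta_ge0 t)).
have pE : pathint X g' t = fun w => (nrm mu g)^-1 * pathint X g t w.
  apply/funext => w; rewrite /pathint Rintegral_scale//.
  have := measurableT_comp (jointly_measurable_Xc hX) (measurable_pair2 w).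
  exact: measurableT_comp sg.1.
move: VD; rewrite Var_pathint//.
have -> : nrm Q (pathint X (impart (ofreal g')) t) = 0.
  rewrite /nrm (_ : dot _ _ _ = 0) ?sqrtr0//.
  rewrite /dot (_ : pathint _ _ _ = cst 0).
    by under eq_Rintegral do rewrite mul0r; rewrite Rintegral_cst// mul0r.
  by apply/funext => w; rewrite /pathint Rintegral_cst// mul0r.
rewrite -[repart (ofreal g')]/g' expr0n/= addr0 lee_fin -exprMn sqrtr_sqr.
rewrite ger0_norm; last by rewrite mulr_ge0 ?nrm_ge0// invr_ge0 ltW.
have -> : nrm Q (pathint X g' t) = (nrm mu g)^-1 * nrm Q (pathint X g t).
  rewrite pE /nrm dotZl//; last exact: sqintZ.
  rewrite dotZr// mulrA -expr2 sqrtrM ?sqr_ge0// sqrtr_sqr ger0_norm//.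
by rewrite ler_pdivrMl// ler_pdivrMl// [X in _ <= X -> _]mulrC.
Qed.

End transfer.

(** * The two bounds *)

Section global_bounds.
Context (R : realType) (d d' : measure_display).
Context (S : measurableType d) (Omega : measurableType d').
Context (P : R.-pker S ~> Omega) (X : R -> Omega -> S) (mu : probability S R).
Hypothesis hX : markov_process P X.
Hypothesis hmu : invariant_measure P X mu.
Hypothesis hP : strongly_continuous P X mu.
Context (t : R) (t0 : 0 < t).

Let hsc := strongly_continuous_real hX hmu hP.

Lemma Var_upper c g : 0 < c -> (c%:E <= sv_gap P X mu)%E ->
  L20 mu g -> L2norm mu g = 1%E -> (Var P X mu t g <= (4 / (c * t))%:E)%E.
Proof.
move=> c0 cg g0 g1; have [/L2P[sr si] /(cintegral_eq0 sr si)[r0 i0]] := g0.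
have bound := variance_upper hX hmu hsc t0 c0
  (fun f h => @sv_gap_le _ _ _ _ _ _ _ _ hX hmu f h c cg).
rewrite (Var_pathint hX hmu t0 g0) !nrm2 lee_fin.
have := lerD (bound _ sr r0) (bound _ si i0).
rewrite -!mulrDr.
have -> : dot mu (repart g) (repart g) + dot mu (impart g) (impart g) = 1.
  move: g1; rewrite L2norm_fin// => -[g1].
  by rewrite -!nrm2 -nrmC_sqr g1 expr1n.
rewrite mulr1 => H; rewrite -ler_pdivlMl ?exprn_gt0 ?invr_gt0//.
apply: (le_trans H); rewrite le_eqVlt; apply/orP; left; apply/eqP.
by field; rewrite !gt_eqF.
Qed.

Lemma Delta_upper c : 0 < c -> (c%:E <= sv_gap P X mu)%E ->
  (Delta P X mu t <= (2 / Num.sqrt (c * t))%:E)%E.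
Proof.
move=> c0 cg; have ct : 0 < c * t by rewrite mulr_gt0.
apply: ge_ereal_sup => _ [[g [g0 g1] <-]|->]; last first.
  by rewrite lee_fin divr_ge0// sqrtr_ge0.
have := Var_upper c0 cg g0 g1.
rewrite (Var_pathint hX hmu t0 g0) /= !lee_fin => H.
apply: (le_trans (ler_wsqrtr H)).
rewrite sqrtrM// sqrtrV ?(ltW ct)//.
have -> : (4 : R) = 2 ^+ 2 by ring.
by rewrite sqrtr_sqr ger0_norm.
Qed.

(** If neither the real nor the imaginary parts satisfied |h| < r |f|, summing
    squares would contradict the bound on the complex quotient. *)
Lemma sup_Delta_lower r D :
  (exists f h, [/\ is_generator P X mu f h, L20 mu f,
    ~ {ae mu, forall x, f x = 0} & (L2norm mu h / L2norm mu f < r%:E)%E]) ->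
  0 <= D -> (forall s, t <= s <= 2 * t -> (Delta P X mu s <= D%:E)%E) ->
  1 <= D * (3 / 2 * r * t + 3).
Proof.
move=> [f [h [fh f0 fn0 hfr]]] D0 HD.
have [fhr fhi] := is_generator_re_im hX hmu fh.
have [sfr shr _] := fhr; have [sfi shi _] := fhi.
have [_ /(cintegral_eq0 sfr sfi)[r0 i0]] := f0.
have HP s g : t <= s <= 2 * t -> sqint mu g -> dot mu (cst 1) g = 0 ->
    nrm (Pmu P mu) (pathint X g s) <= s * D * nrm mu g.
  move=> ts sg g0.
  have s0 : 0 < s by case/andP: ts => ts _; exact: lt_le_trans ts.
  exact: (pathint_le_Delta hX hmu s0 (HD s ts) sg g0).
have F0 : 0 < nrmC mu f.
  rewrite lt_def nrmC_ge0 andbT; apply/eqP => nf0; apply: fn0.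
  have nr : nrm mu (repart f) = 0.
    by apply/eqP; rewrite eq_le nrm_ge0 andbT -nf0 nrm_repart_le.
  have ni : nrm mu (impart f) = 0.
    by apply/eqP; rewrite eq_le nrm_ge0 andbT -nf0 nrm_impart_le.
  apply: filterS2 (nrm_eq0_ae_inv sfr nr) (nrm_eq0_ae_inv sfi ni) => x h1 h2.
  by apply/eqP; rewrite eq_complex -[complex.Re (f x)]/(repart f x) h1
    -[complex.Im (f x)]/(impart f x) h2 !eqxx.
move: hfr; rewrite !L2norm_fin// inver gt_eqF// -EFinM lte_fin.
rewrite ltr_pdivrMr// => hfr.
have H0 : 0 <= nrmC mu h by exact: nrmC_ge0.
have rp : 0 < r by rewrite -(pmulr_lgt0 _ F0) (le_lt_trans H0).
have : nrmC mu h ^+ 2 < (r * nrmC mu f) ^+ 2.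
  by rewrite ltr_sqr ?nnegrE// mulr_ge0// ltW.
rewrite exprMn !nrmC_sqr mulrDr -!exprMn => hsum.
have [hr|hr] := ltP (nrm mu (repart h)) (r * nrm mu (repart f)).
  apply: (variance_lower hX hmu hsc t0 fhr r0 _ (ltW hr) D0 HP).
  by rewrite -(pmulr_rgt0 _ rp) (le_lt_trans _ hr)// nrm_ge0.
have hi : nrm mu (impart h) < r * nrm mu (impart f).
  rewrite ltNge; apply/negP => hi; move: hsum; rewrite ltNge => /negP; apply.
  by apply: lerD; rewrite ler_sqr ?nnegrE ?nrm_ge0// mulr_ge0 ?nrm_ge0// ltW.
apply: (variance_lower hX hmu hsc t0 fhi i0 _ (ltW hi) D0 HP).
by rewrite -(pmulr_rgt0 _ rp) (le_lt_trans _ hi)// nrm_ge0.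
Qed.

End global_bounds.

Local Open Scope ereal_scope.

Theorem corollary1 (R : realType) (d d' : measure_display)
    (S : measurableType d) (Omega : measurableType d')
    (P : R.-pker S ~> Omega) (X : R -> Omega -> S) (mu : probability S R)
    (hX : markov_process P X) (hmu : invariant_measure P X mu)
    (hP : strongly_continuous P X mu) (hgap : 0 < sv_gap P X mu)
    (t : R) (ht : (0 < t)%R) :
  Delta P X mu t <= 2%:E / sqrte (sv_gap P X mu * t%:E) /\
  1 / ((3 / 2)%:E * sv_gap P X mu * t%:E + 3%:E)
    <= ereal_sup [set Delta P X mu s | s in [set s : R | (t <= s <= 2 * t)%R]].
Proof.
have sup_ub s : (t <= s <= 2 * t)%R -> Delta P X mu s <=
    ereal_sup [set Delta P X mu s | s in [set s : R | (t <= s <= 2 * t)%R]].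
  by move=> ts; apply: ereal_sup_ubound; exists s.
have tt : (t <= t <= 2 * t)%R by rewrite lexx; lra.
have sup0 := le_trans (Delta_ge0 P X mu t) (sup_ub _ tt).
split.
  case gE : (sv_gap P X mu) hgap => [c| |//].
    rewrite lte_fin => c0; have ct : (0 < c * t)%R by rewrite mulr_gt0.
    rewrite -EFinM /= inver gt_eqF ?sqrtr_gt0// -EFinM.
    by apply: Delta_upper => //; rewrite gE.
  move=> _; rewrite gt0_mulye ?lte_fin//= invey mule0.
  apply/lee_addgt0Pr => e e0; rewrite add0e.
  (* gamma is infinite, so any c may be used; this one gives the bound e *)
  have c0 : (0 < (2 / e) ^+ 2 / t)%R by rewrite divr_gt0// exprn_gt0// divr_gt0.
  apply: (le_trans (Delta_upper hX hmu hP ht c0 _)); first by rewrite gE leey.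
  rewrite lee_fin divfK ?gt_eqF// sqrtr_sqr ger0_norm; last first.
    by rewrite divr_ge0// ltW.
  by rewrite invf_div mulrC divfK.
move: sup0 sup_ub; set M := ereal_sup _.
case ME : M => [D| |//]; last by move=> *; rewrite leey.
rewrite lee_fin => D0 sup_ub.
case gE : (sv_gap P X mu) hgap => [c| |//]; last first.
  move=> _; rewrite gt0_muley ?lte_fin// gt0_mulye ?lte_fin//=.
  by rewrite div1e invey lee_fin.
rewrite lte_fin => c0.
have pos : (0 < 3 / 2 * c * t + 3)%R by rewrite addr_gt0// !mulr_gt0.
rewrite -!EFinM -EFinD div1e inver gt_eqF// lee_fin -[leLHS]mul1r ler_pdivrMr//.
apply/ler_addgt0Pr => e e0.
(* q is chosen so that replacing c by c + q costs at most e *)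
pose q := (e / ((D + 1) * (3 / 2 * t)))%R.
have q0 : (0 < q)%R by rewrite divr_gt0// mulr_gt0 ?ltr_wpDl// mulr_gt0.
have : sv_gap P X mu < (c + q)%:E by rewrite gE lte_fin ltrDl.
move=> /ereal_inf_lt[_ [f [h [fh f0 fn0 ->]]] hr].
have := @sup_Delta_lower _ _ _ _ _ _ _ _ hX hmu hP t ht (c + q)%R D.
move=> /(_ (ex_intro _ f (ex_intro _ h (And4 fh f0 fn0 hr))) D0 sup_ub) H.
apply: (le_trans H).
rewrite (_ : (D * (3 / 2 * (c + q) * t + 3) =
  D * (3 / 2 * c * t + 3) + D * (q * (3 / 2 * t)))%R); last by ring.
rewrite lerD2l (_ : (q * (3 / 2 * t) = e / (D + 1))%R); last first.
  by rewrite /q; field; rewrite !gt_eqF// ltr_wpDl.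
by rewrite mulrA ler_pdivrMr ?ltr_wpDl// mulrC ler_pM2l// lerDl.
Qed.
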